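(* Let $\mathbb{L}=\mathbb{Z}^-=\{\ldots,-2,-1,0\}$, $\Omega=\{-1,1\}^{\mathbb{L}}$, and let $3/2<p<2$. Let $f=f^{\beta}$ be the power-law Ising ferromagnetic LSS with couplings $J(i,j)=|i-j|^{-p}$, $i\neq j\in\mathbb{L}$, at inverse temperature $\beta>0$. Then $$\sum_{k<i}\mathrm{var}_k^2(f_i)<\infty\qquad\text{for all }i\in\mathbb{L},$$ and yet $f$ exhibits a phase transition at low temperature: $|\mathcal{G}(f^{\beta})|>1$ for all sufficiently large $\beta$. Consequently, the non-shift-invariant version of the Johansson–Öberg criterion (namely: a continuous non-null LSS $f$ with $\sum_{k<i}\mathrm{var}_k^2(f_i)<\infty$ for all $i\in\mathbb{L}$ admits exactly one consistent chain) is false in general.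
   Context: $\Omega=\{-1,1\}^{\mathbb{L}}$ carries the product topology and product $\sigma$-algebra $\mathcal F$; $\mathcal{F}_{\le i}$ is generated by coordinates $\le i$. $\omega_k^n=\omega_{[k,n]}$, $\Omega_k^n=\{-1,1\}^{[k,n]}$, $\omega_{\le n}=\omega_{-\infty}^n=\omega_{(-\infty,n]}$; juxtaposition denotes concatenation. A left singleton-specification (LSS) is a family of probability kernels $f_i:\mathcal{F}_{\le i}\times\Omega\to[0,1]$, $i\in\mathbb{L}$, with $f_i(A\mid\cdot)$ $\mathcal{F}_{\le i-1}$-measurable for $A\in\mathcal{F}_{\le i}$ and $f_i(B\mid\cdot)=\mathbf{1}_B$ for $B\in\mathcal{F}_{\le i-1}$. It is continuous (resp. non-null) if $f_i(\omega_i\mid\cdot)$ is continuous (resp. strictly positive) for all $i$ and $\omega_i$. $\mathcal{G}(f)$ is the set of consistent chains: probability measures $\mu$ on $(\Omega,\mathcal{F})$ with $\mu f_i=\mu$ over $\mathcal{F}_{\le i}$ for every $i\in\mathbb{L}$, where $(\mu f_i)(h)=\int f_i(h\mid\omega)\,\mu(d\omega)$. For $k<i$, $$\mathrm{var}_k(f_i)=\sup_{\omega,\sigma}\big|f_i(\omega_i\mid\omega_{\le i-1})-f_i(\omega_i\mid\omega_{k+1}^{i-1}\,\sigma_{\le k})\big|.$$ The long-range Ising potential at inverse temperature $\beta$ is $\phi_A(\omega)=-\beta J(i,j)\omega_i\omega_j$ if $A=\{i,j\}$ with $i\neq j$, and $\phi_A=0$ for all other finite $A\subset\mathbb{L}$.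 The Ising LSS $f^{\beta}$ is given by $$f_i(\omega_i\mid\omega_{-\infty}^{i-1})=\frac{\sum_{\sigma_{i+1}^0\in\Omega_{i+1}^0}\exp\big[-\sum_{A\cap[i,0]\neq\emptyset}\phi_A(\sigma_{i+1}^0\,\omega_{-\infty}^i)\big]}{\sum_{\sigma_i^0\in\Omega_i^0}\exp\big[-\sum_{A\cap[i,0]\neq\emptyset}\phi_A(\sigma_i^0\,\omega_{-\infty}^{i-1})\big]}$$ (sums in the exponents over finite $A\subset\mathbb{L}$; for $i=0$ the numerator has the single term with configuration $\omega$). *)

(* Defs.v *)
From HB Require Import structures.
From mathcomp Require Import finmap.
From mathcomp Require Import all_boot all_order all_algebra.
From mathcomp Require Import all_classical all_reals all_analysis.
From mathcomp Require Import measurable_realfun zify.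

Set Implicit Arguments.
Unset Strict Implicit.
Unset Printing Implicit Defensive.

Import Order.TTheory GRing.Theory Num.Theory.
Import numFieldNormedType.Exports.

Local Open Scope classical_set_scope.
Local Open Scope ring_scope.

(* The half-line {..., -2, -1, 0}. *)
Definition L : Type := {x : int | x <= 0}.
HB.instance Definition _ := Countable.on L.

Definition site (i : L) : int := val i.

Lemma site_inj : injective site. Proof. exact: val_inj. Qed.

Lemma site_le0 i : site i <= 0. Proof. exact: (valP i). Qed.

(* {-1, 1}^L with the product topology; [true] stands for the spin 1 and
   [false] for the spin -1 (see [spin]). *)
Definition Omega : Type := prod_topology (fun _ : L => bool).
HB.instance Definition _ := Topological.on Omega.
HB.instance Definition _ := isPointed.Build Omega (fun _ => true).

Definition spin {R : realType} (b : bool) : R := if b then 1 else -1.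

Definition coordSets (D : set L) : set_system Omega :=
  [set A | exists j s, D j /\ A = [set w : Omega | w j = s]].

(* Omega with the product sigma-algebra F. *)
Notation OmegaF := (g_sigma_algebraType (coordSets setT)).

(* Omega with the sigma-algebra F_{<= n}; the bound n is an integer so that
   F_{<= i-1} reads [Fle (site i - 1)]. *)
Definition upto (n : int) : set L := [set j | site j <= n].
Notation Fle n := (g_sigma_algebraType (coordSets (upto n))).

Record LSS (R : realType) := MkLSS {
  lss_ker :> forall i : L, R.-pker (Fle (site i - 1)) ~> (Fle (site i)) ;
  lss_proper : forall (i : L) (B : set (Fle (site i - 1))), measurable B ->
    forall w : Omega, lss_ker i w B = (\1_B w)%:E }.

Section LSS_theory.
Context {R : realType}.
Implicit Types f : LSS R.

(* f_i(w_i = s | w) *)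
Definition condp f (i : L) (s : bool) (w : Omega) : R :=
  fine (f i w [set eta : Omega | eta i = s]).

Definition continuousLSS f := forall i s, continuous (condp f i s).

Definition nonnullLSS f := forall i s w, 0 < condp f i s w.

(* w_{k+1}^0 sigma_{<= k} *)
Definition splice (k : L) (w sigma : Omega) : Omega :=
  fun j => if site j <= site k then sigma j else w j.

Definition var (k : L) f (i : L) : R :=
  sup [set `|condp f i (w i) w - condp f i (w i) (splice k w sigma)|
      | w in [set: Omega] & sigma in [set: Omega]].

Definition sqsummable_var f := forall i : L,
  (\esum_(k in [set k : L | (site k < site i)%R]) (var k f i ^+ 2)%:E < +oo)%E.

Definition consistent f (mu : probability OmegaF R) :=
  forall (i : L) (A : set (Fle (site i))), measurable A ->
    (\int[mu]_w f i w A = mu A)%E.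

(* A [probability] is a function on all subsets, unconstrained off the
   sigma-algebra, so chains are compared on measurable sets only. *)
Definition same_chain (mu nu : probability OmegaF R) :=
  forall A : set OmegaF, measurable A -> mu A = nu A.

(* |G(f)| > 1 *)
Definition several_chains f := exists mu nu,
  [/\ consistent f mu, consistent f nu & ~ same_chain mu nu].

(* |G(f)| = 1 *)
Definition unique_chain f := exists mu, consistent f mu /\
  forall nu, consistent f nu -> same_chain mu nu.

End LSS_theory.

(* Omega_{1-m}^0: the site -t is indexed by t : 'I_m. *)
Definition window (m : nat) := {ffun 'I_m -> bool}.

(* sigma_{1-m}^0 w_{<= -m} *)
Definition concat m (sigma : window m) (w : Omega) : Omega :=
  fun j => if insub `|site j|%N is Some t then sigma t else w j.

Definition update (i : L) (s : bool) (w : Omega) : Omega :=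
  fun j => if j == i then s else w j.

(* Unordered sum of a real family over S; meaningful when the family is
   absolutely summable. *)
Definition usum {R : realType} {T : choiceType} (S : set T) (a : T -> R) : R :=
  fine (\esum_(x in S) (EFin \o a)^\+ x - \esum_(x in S) (EFin \o a)^\- x)%E.

Section potential.
Context {R : realType} (phi : {fset L} -> Omega -> R).

Definition meeting (i : L) : set {fset L} :=
  [set A : {fset L} | exists2 j, j \in A & site i <= site j].

Definition energy (i : L) (w : Omega) : R := usum (meeting i) (phi^~ w).

Definition leftNum (i : L) (w : Omega) : R :=
  \sum_(sigma : window `|site i|%N) expR (- energy i (concat sigma w)).

Definition leftDen (i : L) (w : Omega) : R :=
  \sum_(sigma : window `|site i|%N.+1) expR (- energy i (concat sigma w)).

(* f_i(w_i | w_{<= i-1}); the windows of [leftNum] and [leftDen] are [i+1, 0]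
   and [i, 0] since site i = - `|site i|. *)
Definition leftDensity (i : L) (w : Omega) : R := leftNum i w / leftDen i w.

End potential.

Section measurability.

Lemma coordSets_measurable (D : set L) (j : L) (B : set bool) : D j ->
  measurable ((fun w : Omega => w j) @^-1` B :
    set (g_sigma_algebraType (coordSets D))).
Proof.
move=> Dj.
have mb s : measurable ([set w : Omega | w j = s] :
    set (g_sigma_algebraType (coordSets D))).
  by apply: sub_sigma_algebra; exists j, s.
have -> : (fun w : Omega => w j) @^-1` B =
   \bigcup_(s in B) [set w : Omega | w j = s].
  apply/seteqP; split => [w /= Bw|w [s Bs /= ->]//].
  by exists (w j).
by apply: fin_bigcup_measurable => //; exact: finite_finset.
Qed.

Lemma measurable_Omega d (T : measurableType d) (D : set L)
    (g : T -> Omega) :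
  (forall j, D j -> measurable_fun setT (fun t => g t j)) ->
  measurable_fun setT (g : T -> g_sigma_algebraType (coordSets D)).
Proof.
move=> mg; apply: (@measurability _ _ T (g_sigma_algebraType (coordSets D)) setT g
  (coordSets D)) => //.
move=> _ [_ [j [s [Dj ->]]] <-].
have /(_ measurableT [set s]) := mg j Dj; exact.
Qed.

Lemma measurable_coord (D : set L) (j : L) : D j ->
  measurable_fun setT
    (fun w : g_sigma_algebraType (coordSets D) => (w : Omega) j).
Proof. by move=> Dj _ B _; rewrite setTI; exact: coordSets_measurable. Qed.

Lemma coordSets_local (D : set L) (B : set (g_sigma_algebraType (coordSets D)))
    (w w' : Omega) :
  measurable B -> (forall j, D j -> w j = w' j) -> B w -> B w'.
Proof.
move=> mB ww'.
suff: [set B : set Omega | B w <-> B w'] B by move=> [].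
apply: (@smallest_sub _ _ (coordSets D)) mB.
  split => //= [A [AB BA]|F Fww'].
    by split => -[_ nA]; split => // Aw; apply: nA; [exact: BA|exact: AB].
  by split => -[n _ Fn]; exists n => //; apply/Fww'.
by move=> _ [j [s [Dj ->]]] /=; rewrite ww'.
Qed.

Lemma measurable_concat (n : int) m (sigma : window m) : (- m%:Z <= n) ->
  measurable_fun setT (concat sigma : Fle n -> OmegaF).
Proof.
move=> nm; apply: measurable_Omega => j _; rewrite /concat.
case: insubP => [t _ _|]; first exact: measurable_cst.
rewrite -leqNgt => mj; apply: measurable_coord; rewrite /upto /=.
have := site_le0 j; lia.
Qed.

Lemma measurable_update (i : L) (s : bool) :
  measurable_fun setT (update i s : Fle (site i - 1) -> Fle (site i)).
Proof.
apply: measurable_Omega => j ji; rewrite /update.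
case: eqP => [_|/eqP ij]; first exact: measurable_cst.
apply: measurable_coord; move: ji ij; rewrite /upto /= -(inj_eq site_inj).
lia.
Qed.

Lemma measurable_esum (R : realType) d (X : measurableType d) (T : countType)
    (S : set T) (a : T -> X -> \bar R) :
  (forall t x, 0 <= a t x)%E -> (forall t, measurable_fun setT (a t)) ->
  measurable_fun setT (fun x => \esum_(t in S) a t x)%E.
Proof.
move=> a0 ma.
pose b n x : \bar R := if @choice.unpickle T n is Some t then a t x else 0%E.
have b0 n x : (0 <= b n x)%E by rewrite /b; case: choice.unpickle.
have -> : (fun x => \esum_(t in S) a t x)%E =
    (fun x => \sum_(n <oo | n \in mem (@choice.pickle T @` S)) b n x)%E.
  apply/funext => x; rewrite nneseries_esum//=.
  rewrite set_mem_set esum_image; last by move=> t u _ _ /(pcan_inj choice.pickleK).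
  by apply: eq_esum => t _; rewrite /b choice.pickleK.
apply: ge0_emeasurable_sum => // n _; rewrite /b.
by case: choice.unpickle => [t|]; [exact: ma|exact: measurable_cst].
Qed.

Lemma measurable_usum (R : realType) d (X : measurableType d) (T : countType)
    (S : set T) (a : T -> X -> R) :
  (forall t, measurable_fun setT (a t)) ->
  measurable_fun setT (fun x => usum S (a^~ x)).
Proof.
move=> ma; apply: measurableT_comp => //.
have mEa t : measurable_fun setT (EFin \o a t) by exact/measurable_EFinP.
apply: emeasurable_funB; apply: measurable_esum => t.
- by move=> x; exact: funepos_ge0.
- rewrite [X in measurable_fun _ X](_ : _ = (EFin \o a t)^\+%E).
    exact: measurable_funepos.
  by apply/funext => x; rewrite !funeposE.
- by move=> x; exact: funeneg_ge0.
- rewrite [X in measurable_fun _ X](_ : _ = (EFin \o a t)^\-%E).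
    exact: measurable_funeneg.
  by apply/funext => x; rewrite !funenegE.
Qed.

End measurability.

Section leftLSS.
Context {R : realType} (phi : {fset L} -> Omega -> R).
Context (mphi : forall A, measurable_fun setT (phi A : OmegaF -> R)).

Lemma measurable_energy (i : L) :
  measurable_fun setT (energy phi i : OmegaF -> R).
Proof. exact: measurable_usum. Qed.

Lemma measurable_boltzmann (i : L) (n : int) m : - m%:Z <= n ->
  measurable_fun setT ((fun w => \sum_(sigma : window m)
    expR (- energy phi i (concat sigma w))) : Fle n -> R).
Proof.
move=> mn; apply: measurable_sum => sigma.
apply: measurableT_comp => //; apply: measurableT_comp => //.
apply: (measurableT_comp (measurable_energy i)).
exact: measurable_concat.
Qed.

Lemma leftDen_gt0 (i : L) w : 0 < leftDen phi i w.
Proof.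
rewrite /leftDen (bigD1 [ffun=> true])//= ltr_pwDl ?expR_gt0//.
by apply: sumr_ge0 => sigma _; exact: expR_ge0.
Qed.

Lemma leftNum_gt0 (i : L) w : 0 < leftNum phi i w.
Proof.
rewrite /leftNum (bigD1 [ffun=> true])//= ltr_pwDl ?expR_gt0//.
by apply: sumr_ge0 => sigma _; exact: expR_ge0.
Qed.

Lemma leftDensity_ge0 (i : L) w : 0 <= leftDensity phi i w.
Proof. by rewrite ltW// divr_gt0 ?leftNum_gt0 ?leftDen_gt0. Qed.

Lemma measurable_leftDensity (i : L) :
  measurable_fun setT (leftDensity phi i : Fle (site i) -> R).
Proof.
have absi : `|site i|%N%:Z = - site i by rewrite abszE ler0_norm// site_le0.
apply: measurable_funM.
  by apply: (@measurable_boltzmann i (site i) `|site i|%N); rewrite absi; lia.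
have mD : measurable_fun setT (leftDen phi i : Fle (site i) -> R).
  apply: (@measurable_boltzmann i (site i) `|site i|%N.+1).
  by rewrite -addn1 PoszD absi; lia.
rewrite (_ : (fun w => _) =
    expR \o (\- (@ln R \o (leftDen phi i : Fle (site i) -> R)))); last first.
  by apply/funext => w /=; rewrite expRN lnK// posrE leftDen_gt0.
apply: (measurableT_comp (@measurable_expR R)); apply: measurable_funN.
exact: (measurableT_comp (@measurable_ln R) mD).
Qed.

Lemma measurable_leftDensity_update (i : L) s :
  measurable_fun setT
    (leftDensity phi i \o update i s : Fle (site i - 1) -> R).
Proof.
exact: (measurableT_comp (@measurable_leftDensity i) (@measurable_update i s)).
Qed.

Definition leftWeight (i : L) (w : Omega) (s : bool) : {nonneg R} :=
  NngNum (leftDensity_ge0 i (update i s w)).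

(* f_i(A | w) = sum_s f_i(s | w_{<= i-1}) 1_A(w_{<= i-1} s) *)
Definition leftKer (i : L) (w : Fle (site i - 1)) :
    {measure set (Fle (site i)) -> \bar R} :=
  measure_add
    (mscale (leftWeight i w true) (dirac (update i true w : Fle (site i))))
    (mscale (leftWeight i w false) (dirac (update i false w : Fle (site i)))).

Lemma leftKerE (i : L) w (A : set (Fle (site i))) : leftKer w A =
  (\sum_(s : bool) leftDensity phi i (update i s w) * \1_A (update i s w))%:E.
Proof.
rewrite [LHS]measure_addE /mscale /= /mscale /= !diracE.
by rewrite big_bool /= EFinD !EFinM !indicE.
Qed.

Lemma measurable_leftKer (i : L) (A : set (Fle (site i))) : measurable A ->
  measurable_fun setT (fun w => leftKer w A).
Proof.
move=> mA; rewrite (funext (fun w => leftKerE w A)).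
apply/measurable_EFinP; apply: measurable_sum => s.
apply: measurable_funM; first exact: measurable_leftDensity_update.
apply: (measurableT_comp _ (@measurable_update i s)).
exact: measurable_indic.
Qed.

HB.instance Definition _ (i : L) :=
  isKernel.Build _ _ _ _ R (@leftKer i) (@measurable_leftKer i).

Lemma leftKer_setT (i : L) w : @leftKer i w setT = 1%E.
Proof.
have dsplit s : leftDensity phi i (update i s w) =
    leftNum phi i (update i s w) / leftDen phi i w.
  congr (_ / _); apply: eq_bigr => sigma _; congr (expR (- energy _ _ _)).
  apply/funext => j; rewrite /concat /update; case: insubP => //.
  case: eqP => // ->; rewrite ltnS leqnn //.
rewrite leftKerE; congr (_%:E).
under eq_bigr do rewrite indicE in_setT mulr1 dsplit.
rewrite -mulr_suml.
suff -> : \sum_s leftNum phi i (update i s w) = leftDen phi i w.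
  by rewrite divff// gt_eqF// leftDen_gt0.
rewrite /leftNum pair_big /=.
pose h (c : bool * window `|site i|%N) : window `|site i|%N.+1 :=
  [ffun t => if unlift ord_max t is Some u then c.2 u else c.1].
pose g (c : window `|site i|%N.+1) : bool * window `|site i|%N :=
  (c ord_max, [ffun u => c (lift ord_max u)]).
have hK : cancel h g.
  move=> [s c]; rewrite /g /h ffunE unlift_none; congr pair.
  by apply/ffunP => u; rewrite !ffunE liftK.
have gK : cancel g h.
  move=> c; apply/ffunP => t; rewrite /h ffunE.
  by case: unliftP => [u|] -> //; rewrite ffunE.
rewrite [RHS](reindex h); last by apply: onW_bij; exists g.
apply: eq_bigr => -[s c] _ /=; congr (expR (- energy _ _ _)).
apply/funext => j; rewrite /concat /update.
case: insubP => [u uj ju|nj]; case: insubP => [t tj jt|nj'] //.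
- rewrite ffunE.
  suff -> : t = lift ord_max u by rewrite liftK.
  by apply: val_inj; rewrite [LHS]jt -ju; exact/esym/lift_max.
- by move: nj'; rewrite ltnS ltnW.
- rewrite ffunE.
  have tm : t = ord_max.
    apply: val_inj; rewrite jt /=; apply/eqP.
    by rewrite eqn_leq -ltnS tj leqNgt.
  rewrite tm unlift_none ifT//; apply/eqP/site_inj.
  have := site_le0 i; have := site_le0 j; move: jt; rewrite tm /=; lia.
- rewrite ifF//; apply/eqP => ji; move: nj'; rewrite ji ltnS leqnn.
  by [].
Qed.

HB.instance Definition _ (i : L) :=
  Kernel_isProbability.Build _ _ _ _ R (@leftKer i) (@leftKer_setT i).

Lemma leftKer_proper (i : L) (B : set (Fle (site i - 1))) : measurable B ->
  forall w, leftKer w B = (\1_B w)%:E.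
Proof.
move=> mB w.
have Bupd s : \1_B (update i s w) = \1_B w :> R.
  have wj j : upto (site i - 1) j -> w j = update i s w j.
    rewrite /upto /update /= => ji; case: eqP => // jj.
    by move: ji; rewrite jj; lia.
  rewrite !indicE; congr (_%:R); congr nat_of_bool.
  apply/idP/idP; rewrite !inE; apply: coordSets_local => // j /wj.
  exact: esym.
have := leftKer_setT w; rewrite !leftKerE.
under eq_bigr do rewrite indicE in_setT mulr1.
under [in X in _ -> X]eq_bigr do rewrite Bupd.
by rewrite -mulr_suml => -[->]; rewrite mul1r.
Qed.

Definition leftLSS : LSS R := MkLSS leftKer_proper.

Lemma condp_leftLSS (i : L) (s : bool) (w : Omega) :
  condp leftLSS i s w = leftDensity phi i (update i s w).
Proof.
rewrite /condp [X in fine X](leftKerE w) /=.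
rewrite (bigD1 s)//= big1 ?addr0 => [|t ts].
  by rewrite indicE mem_set ?mulr1//= /update eqxx.
rewrite indicE memNset ?mulr0//= /update eqxx => tE.
by rewrite tE eqxx in ts.
Qed.

End leftLSS.

Section ising.
Context {R : realType}.

(* phi_A(w) = - beta J(i, j) w_i w_j if A = {i, j} with i != j and 0 for all
   other A: when A has two elements, the double sum has exactly one term. *)
Definition isingPotential (beta : R) (J : L -> L -> R) (A : {fset L})
    (w : Omega) : R :=
  if #|` A| == 2 then
    - beta * \sum_(i <- A) \sum_(j <- A | (site i < site j)%R)
      J i j * spin (w i) * spin (w j)
  else 0.

Lemma isingPotential_pair beta (J : L -> L -> R) (i j : L) w :
  J i j = J j i -> i != j ->
  isingPotential beta J [fset i; j]%fset w =
  - beta * J i j * spin (w i) * spin (w j).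
Proof.
move=> Jij ij; rewrite /isingPotential cardfs2 ij /= -!mulrA; congr (_ * _).
have pij : perm_eq [fset i; j]%fset [:: i; j].
  apply: uniq_perm; rewrite ?fset_uniq//= ?inE ?ij// => k.
  by rewrite !inE.
rewrite (perm_big _ pij) big_cons big_seq1 !(perm_big _ pij) !big_cons !big_nil.
rewrite !ltxx; have [ij'|ji|/site_inj ij'] := ltgtP (site i) (site j).
- by rewrite /= !addr0 mulrA.
- by rewrite /= !addr0 add0r Jij -mulrA [spin _ * _]mulrC.
- by rewrite ij' eqxx in ij.
Qed.

Lemma measurable_isingPotential beta J (A : {fset L}) :
  measurable_fun setT (isingPotential beta J A : OmegaF -> R).
Proof.
rewrite /isingPotential; case: (_ == _); last exact: measurable_cst.
apply: measurable_funM; first exact: measurable_cst.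
apply: measurable_sum => i.
rewrite [X in measurable_fun _ X](_ : _ = fun w : Omega => \sum_(j <- A)
    if (site i < site j)%R then J i j * spin (w i) * spin (w j) else 0); last first.
  by apply/funext => w; rewrite big_mkcond.
apply: measurable_sum => j; case: (_ < _); last exact: measurable_cst.
have ms (k : L) : measurable_fun setT ((fun w => spin (w k)) : OmegaF -> R).
  by move=> _ B _; rewrite setTI; exact: (@coordSets_measurable setT k (spin @^-1` B)).
apply: measurable_funM => //; apply: measurable_funM => //.
Qed.

Definition isingLSS (beta : R) (J : L -> L -> R) : LSS R :=
  leftLSS (measurable_isingPotential beta J).

Definition powerCoupling (p : R) (i j : L) : R :=
  (`|site i - site j|%:~R : R) `^ (- p).

End ising.

(* Main.v *)
Require Import Defs.
From HB Require Import structures.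
From mathcomp Require Import finmap.
From mathcomp Require Import all_boot all_order all_algebra.
From mathcomp Require Import all_classical all_reals all_analysis.
From mathcomp Require Import measurable_realfun zify ring lra.

(* The energy difference caused by changing the past of w before distance n
   from the window is at most a constant times the sum of q^-p over q >= n,
   i.e. O(n^(1-p)), so var_k(f_i) = O((i-k)^(1-p)), which is square summable
   for p > 3/2.

   A measure whose finite-volume conditional laws on the windows [i, 0] are the
   Gibbs ones is a consistent chain; such measures are obtained as (ultrafilter)
   limits of the Gibbs measures on windows of size 2^n with all-plus and
   all-minus boundary. That the two limits differ is Dyson's phase transition
   for p < 2. By the second Griffiths inequality, lowering the couplings to
   those of a hierarchical model, and the field created by the plus boundary to
   a constant h of order beta 2^(n(1-p)), lowers the magnetization. In the
   hierarchical model let M_n be the free mean of |S_n|, S_n the sum of the 2^n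
   spins. Flipping one of the two halves shows that, given the absolute values
   a and b of the magnetizations of the halves, the weight is cosh(K a b);
   reweighting by this increasing function does not decrease a + b, while the
   signs disagree only at a cost 1/sqrt(K). So M_(n+1) >= 2 M_n - 1/sqrt(K)
   with K = beta 2^(-p(n+1)), and M_n / 2^n stays close to 1 for large beta
   since p < 2. A field h turns this into magnetization up to an error 1/h. *)

Set Implicit Arguments.
Unset Strict Implicit.
Unset Printing Implicit Defensive.
Import Order.TTheory GRing.Theory Num.Theory.
Import numFieldNormedType.Exports.
Local Open Scope classical_set_scope.
Local Open Scope ring_scope.

(** * Griffiths inequalities *)

Section griffiths.
Context {R : realType} (T : finType) (mul : T -> T -> T).
Hypothesis mulI : forall s, injective (mul s).

(** Abstract form of a product of spins. *)
Definition character (chi : T -> R) :=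
  (forall s t, chi (mul s t) = chi s * chi t) /\ forall s, chi s ^+ 2 = 1.

(** The cone of ferromagnetic Hamiltonians, built one interaction at a time so that the correlation
    inequalities go by induction on the interactions. *)
Inductive ferro : (T -> R) -> Prop :=
| ferro0 : ferro (fun=> 0)
| ferro_cons c chi F : 0 <= c -> character chi -> ferro F ->
    ferro (fun s => c * chi s + F s).

Definition gibbs_mean (F chi : T -> R) : R :=
  (\sum_s chi s * expR (F s)) / \sum_s expR (F s).

Lemma character_pm1 chi s : character chi -> chi s = 1 \/ chi s = -1.
Proof.
by case=> _ /(_ s) /eqP; rewrite sqrf_eq1 => /orP[/eqP ->|/eqP ->]; [left|right].
Qed.

Lemma characterM chi psi : character chi -> character psi ->
  character (fun s => chi s * psi s).
Proof.
move=> [cM c2] [pM p2]; split=> [s t|s]; first by rewrite cM pM; ring.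
by rewrite exprMn c2 p2 mulr1.
Qed.

(** If [chi t = -1] for some [t], translation by [t] negates the sum, which therefore vanishes;
    otherwise every term is 1. *)
Lemma sum_character_ge0 chi : character chi -> 0 <= \sum_s chi s.
Proof.
move=> hchi; have [all1|] := pselect (forall s, chi s = 1).
  by apply: sumr_ge0 => s _; rewrite all1.
move=> /existsNP[t chit].
have ct : chi t = -1 by case: (character_pm1 t hchi).
have : \sum_s chi s = \sum_s chi (mul t s).
  by rewrite [LHS](reindex_inj (mulI (s := t))).
under [in RHS]eq_bigr do rewrite hchi.1 ct mulN1r.
rewrite sumrN => e; lra.
Qed.

Lemma expR_character c chi s : character chi ->
  expR (c * chi s) = (expR c + expR (- c)) / 2 + (expR c - expR (- c)) / 2 * chi s.
Proof. by case/(character_pm1 s) => ->; rewrite ?mulr1 ?mulrN1; lra. Qed.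

Lemma ge0_sinh (c : R) : 0 <= c -> 0 <= (expR c - expR (- c)) / 2.
Proof. by move=> c0; rewrite divr_ge0// subr_ge0 ler_expR; lra. Qed.

(** First Griffiths inequality. Each factor [expR (c * psi s)] is cosh c + sinh c psi(s) with
    nonnegative coefficients, and products of characters are characters. *)
Lemma ferro_sum_ge0 F chi : ferro F -> character chi ->
  0 <= \sum_s chi s * expR (F s).
Proof.
move=> hF; elim: hF chi => {F} [|c psi F c0 hpsi _ IH] chi hchi.
  by under eq_bigr do rewrite expR0 mulr1; exact: sum_character_ge0.
have -> : \sum_s chi s * expR (c * psi s + F s) =
    (expR c + expR (- c)) / 2 * (\sum_s chi s * expR (F s)) +
    (expR c - expR (- c)) / 2 * (\sum_s chi s * psi s * expR (F s)).
  rewrite !mulr_sumr -big_split; apply: eq_bigr => s _ /=.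
  by rewrite expRD (expR_character _ _ hpsi); ring.
apply: addr_ge0; apply: mulr_ge0.
- by rewrite divr_ge0// addr_ge0 ?expR_ge0.
- exact: IH.
- exact: ge0_sinh.
- exact: IH (characterM hchi hpsi).
Qed.

Lemma ferroD F G : ferro F -> ferro G -> ferro (fun s => F s + G s).
Proof.
elim=> [|c chi {}F c0 hchi hF IH] hG.
  by rewrite [X in ferro X](_ : _ = G)//; apply/funext => s; rewrite add0r.
rewrite [X in ferro X](_ : _ = (fun s => c * chi s + (F s + G s))); last first.
  by apply/funext => s; rewrite addrA.
by apply: ferro_cons => //; exact: IH.
Qed.

Lemma ferro_char c chi : 0 <= c -> character chi -> ferro (fun s => c * chi s).
Proof.
move=> c0 hchi; rewrite [X in ferro X](_ : _ = (fun s => c * chi s + 0)); last first.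
  by apply/funext => s; rewrite addr0.
by apply: ferro_cons => //; exact: ferro0.
Qed.

Lemma ferro_sum (I : Type) (r : seq I) (P : pred I) (F : I -> T -> R) :
  (forall i, P i -> ferro (F i)) -> ferro (fun s => \sum_(i <- r | P i) F i s).
Proof.
move=> hF; elim: r => [|i r IH].
  by rewrite [X in ferro X](_ : _ = fun=> 0); [exact: ferro0|
    apply/funext => s; rewrite big_nil].
have [Pi|nPi] := boolP (P i).
  rewrite [X in ferro X](_ : _ = fun s => F i s + \sum_(i <- r | P i) F i s).
    by apply: ferroD => //; exact: hF.
  by apply/funext => s; rewrite big_cons Pi.
rewrite [X in ferro X](_ : _ = fun s => \sum_(i <- r | P i) F i s)//.
by apply/funext => s; rewrite big_cons (negbTE nPi).
Qed.

(* Ginibre's duplication: in a doubled system (s, s') substitute s' = s t; for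
   fixed t the doubled Hamiltonian is again ferromagnetic. *)
Lemma ferro_duplicate F t : ferro F -> ferro (fun s => F s + F (mul s t)).
Proof.
elim=> [|c chi {}F c0 hchi hF IH].
  by rewrite [X in ferro X](_ : _ = fun=> 0); [exact: ferro0|
    apply/funext => s; rewrite addr0].
rewrite [X in ferro X](_ : _ =
  (fun s => (c * (1 + chi t)) * chi s + (F s + F (mul s t)))); last first.
  by apply/funext => s; rewrite hchi.1; ring.
apply: ferro_cons => //; apply: mulr_ge0 => //.
by case: (character_pm1 t hchi) => ->; lra.
Qed.

(** Second Griffiths inequality. The gap is a double sum over [s] and [t]; after replacing [t] by
    [mul s t] the factor [psi s - psi t] becomes [psi s * (1 - psi t)]. Since [1 - psi t] is
    nonnegative, the first inequality for the duplicated Hamiltonian concludes for each [t]. *)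
Lemma griffiths2 F chi psi : ferro F -> character chi -> character psi ->
  (\sum_s chi s * expR (F s)) * (\sum_s psi s * expR (F s)) <=
  (\sum_s chi s * psi s * expR (F s)) * (\sum_s expR (F s)).
Proof.
move=> hF hchi hpsi; rewrite -subr_ge0.
have -> : (\sum_s chi s * psi s * expR (F s)) * (\sum_s expR (F s)) -
    (\sum_s chi s * expR (F s)) * (\sum_s psi s * expR (F s)) =
    \sum_s \sum_t chi s * (psi s - psi t) * (expR (F s) * expR (F t)).
  rewrite !mulr_suml -sumrB; apply: eq_bigr => s _.
  by rewrite !mulr_sumr -sumrB; apply: eq_bigr => t _; ring.
under eq_bigr => s _ do rewrite (reindex_inj (mulI (s := s))).
rewrite exchange_big; apply: sumr_ge0 => t _.
rewrite (eq_bigr (fun s => (1 - psi t) *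
    (chi s * psi s * expR (F s + F (mul s t))))); last first.
  by move=> s _; rewrite hpsi.1 expRD; ring.
rewrite -mulr_sumr; apply: mulr_ge0.
  by case: (character_pm1 t hpsi) => ->; lra.
by apply: ferro_sum_ge0; [exact: ferro_duplicate|exact: characterM].
Qed.

Lemma sum_expR_gt0 (F : T -> R) (s0 : T) : 0 < \sum_s expR (F s).
Proof.
rewrite (bigD1 s0)//= ltr_pwDl ?expR_gt0//.
by apply: sumr_ge0 => s _; exact: expR_ge0.
Qed.

(** Once the means are cross-multiplied and [expR (c * psi s)] is expanded as above, the cosh terms
    cancel and sinh c times the gap of [griffiths2] remains. *)
Lemma gibbs_mean_cons F c chi psi (s0 : T) : ferro F -> 0 <= c ->
  character chi -> character psi ->
  gibbs_mean F chi <= gibbs_mean (fun s => c * psi s + F s) chi.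
Proof.
move=> hF c0 hchi hpsi; rewrite /gibbs_mean.
rewrite ler_pdivrMr ?sum_expR_gt0// mulrAC ler_pdivlMr ?sum_expR_gt0//.
set C := (expR c + expR (- c)) / 2; set S := (expR c - expR (- c)) / 2.
have -> : \sum_s expR (c * psi s + F s) =
    C * (\sum_s expR (F s)) + S * (\sum_s psi s * expR (F s)).
  rewrite !mulr_sumr -big_split; apply: eq_bigr => s _ /=.
  by rewrite expRD (expR_character _ _ hpsi) -/C -/S; ring.
have -> : \sum_s chi s * expR (c * psi s + F s) =
    C * (\sum_s chi s * expR (F s)) + S * (\sum_s chi s * psi s * expR (F s)).
  rewrite !mulr_sumr -big_split; apply: eq_bigr => s _ /=.
  by rewrite expRD (expR_character _ _ hpsi) -/C -/S; ring.
have := griffiths2 hF hchi hpsi; rewrite -subr_ge0 => h2.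
rewrite -subr_ge0; have := mulr_ge0 (ge0_sinh c0) h2; rewrite -/S => h3.
by apply: le_trans h3 _; rewrite le_eqVlt; apply/orP; left; apply/eqP; ring.
Qed.

Lemma gibbs_mean_mono F D chi (s0 : T) : ferro F -> ferro D -> character chi ->
  gibbs_mean F chi <= gibbs_mean (fun s => D s + F s) chi.
Proof.
move=> hF hD hchi; elim: hD => [|c psi {}D c0 hpsi hD IH].
  by rewrite [X in _ <= gibbs_mean X _](_ : _ = F)//; apply/funext => s; rewrite add0r.
apply: le_trans IH _.
rewrite [X in _ <= gibbs_mean X _](_ : _ = fun s => c * psi s + (D s + F s)).
  by apply: gibbs_mean_cons => //; exact: ferroD.
by apply/funext => s; rewrite addrA.
Qed.

End griffiths.

(** * Dyson's hierarchical model *)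

Section hyperbolic.
Context {R : realType}.

Definition coshR (u : R) := (expR u + expR (- u)) / 2.

Lemma coshR_ge1 u : 1 <= coshR u.
Proof.
rewrite /coshR; have := expR_ge1Dx u; have := expR_ge1Dx (- u); lra.
Qed.

Lemma coshR_le u v : 0 <= u -> u <= v -> coshR u <= coshR v.
Proof.
move=> u0 uv; rewrite /coshR ler_pM2r ?invr_gt0// -subr_ge0.
have -> : expR v + expR (- v) - (expR u + expR (- u)) =
    (expR v - expR u) * (1 - expR (- u - v)).
  rewrite expRD !expRN; field; rewrite ?gt_eqF ?expR_gt0//.
by apply: mulr_ge0; rewrite subr_ge0 ?ler_expR// expR_le1; lra.
Qed.

Lemma coshRN u : coshR (- u) = coshR u.
Proof. by rewrite /coshR opprK addrC. Qed.

Lemma coshR_norm u : coshR `|u| = coshR u.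
Proof. by case: (ger0P u) => // _; exact: coshRN. Qed.

End hyperbolic.

(** Chebyshev's association inequality: similarly ordered functions are positively correlated, as
    seen by expanding the nonnegative double sum of [(f a - f b) * (g a - g b)]. *)
Lemma chebyshev_sum (R : realType) (T : finType) (W f g : T -> R) :
  (forall a, 0 <= W a) -> (forall a b, 0 <= (f a - f b) * (g a - g b)) ->
  (\sum_a W a * f a) * (\sum_a W a * g a) <=
  (\sum_a W a) * (\sum_a W a * f a * g a).
Proof.
move=> W0 fg; have : 0 <= \sum_a \sum_b W a * W b * ((f a - f b) * (g a - g b)).
  by apply: sumr_ge0 => a _; apply: sumr_ge0 => b _; apply: mulr_ge0 => //;
    exact: mulr_ge0.
have -> : \sum_a \sum_b W a * W b * ((f a - f b) * (g a - g b)) =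
  \sum_a \sum_b (W a * f a * g a) * W b + \sum_a \sum_b W a * (W b * f b * g b)
  - \sum_a \sum_b (W a * f a) * (W b * g b)
  - \sum_a \sum_b (W a * g a) * (W b * f b).
  rewrite -big_split/= -!sumrB; apply: eq_bigr => a _.
  by rewrite -big_split/= -!sumrB; apply: eq_bigr => b _; ring.
rewrite -!big_distrlr /=; lra.
Qed.

Section block.
Context {R : realType} (T : finType) (W S : T -> R) (flip : T -> T).
Hypotheses (W0 : forall a, 0 <= W a) (Z0 : 0 < \sum_a W a)
  (flipI : injective flip) (flipW : forall a, W (flip a) = W a)
  (flipS : forall a, S (flip a) = - S a).

Let A := (\sum_a W a * `|S a|) / \sum_a W a.

(** The weight is invariant under [flip], which negates [S], so only the even part of [F] counts. *)
Lemma block_symm (F : R -> R) :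
  \sum_a W a * F (S a) = \sum_a W a * ((F (S a) + F (- S a)) / 2).
Proof.
have e : \sum_a W a * F (S a) = \sum_a W a * F (- S a).
  by rewrite [LHS](reindex_inj flipI); apply: eq_bigr => a _; rewrite flipW flipS.
under [RHS]eq_bigr do rewrite mulrA mulrDr.
by rewrite -mulr_suml big_split/= -e; lra.
Qed.

(** The fraction is m = min(x, y), and m^2 <= x y, so the bound follows from k m <= 1 + (k m)^2 <=
    exp((k m)^2). *)
Lemma min_expR_le (k x y : R) : 0 < k -> 0 <= x -> 0 <= y ->
  expR (- (k ^+ 2 * (x * y))) * ((x + y - `|x - y|) / 2) <= k^-1.
Proof.
move=> k0 x0 y0.
wlog xy : x y x0 y0 / x <= y => [h|].
  have [|/ltW] := leP x y; first exact: h.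
  by move=> yx; have := h _ _ y0 x0 yx; rewrite distrC (addrC y) (mulrC y).
rewrite ler0_norm ?subr_le0// (_ : (x + y - - (x - y)) / 2 = x); last by lra.
rewrite expRN mulrC ler_pdivrMr ?expR_gt0// mulrC ler_pdivlMr//.
apply: (@le_trans _ _ (1 + (k * x) ^+ 2)); first by nra.
apply: le_trans (expR_ge1Dx _) _; rewrite ler_expR exprMn ler_pM2l ?exprn_gt0//.
by rewrite expr2 ler_wpM2l.
Qed.

(** For nonnegative x and y the right-hand side is exactly cosh(k^2 x y) (x + y) minus the quantity
    bounded by [min_expR_le]. Changing the sign of x or y at most exchanges the two terms on the
    right. *)
Lemma coshR_sum_norm (k x y : R) : 0 < k ->
  coshR (k ^+ 2 * (`|x| * `|y|)) * (`|x| + `|y|) - k^-1 <=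
  (expR (k ^+ 2 * (x * y)) * `|x + y| + expR (k ^+ 2 * (x * - y)) * `|x - y|) / 2.
Proof.
move=> k0.
have pos u v : 0 <= u -> 0 <= v -> coshR (k ^+ 2 * (u * v)) * (u + v) - k^-1 <=
  (expR (k ^+ 2 * (u * v)) * (u + v) + expR (k ^+ 2 * (u * - v)) * `|u - v|) / 2.
  move=> u0 v0; have := min_expR_le k0 u0 v0.
  rewrite /coshR !mulrN; set e := expR _; set e' := expR _; lra.
case: (ger0P x) => x0; case: (ger0P y) => y0.
- by have := pos x y x0 y0; rewrite (@ger0_norm _ (x + y))// addr_ge0.
- have := pos x (- y) x0; rewrite !opprK => /(_ ltac:(lra)).
  rewrite (@ger0_norm _ (x - y)); [lra|lra].
- have := pos (- x) y; rewrite mulrNN -(opprD x y) normrN (mulNr x y) -(mulrN x y).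
  move=> /(_ ltac:(lra) y0).
  by rewrite (@ler0_norm _ (x - y)); [lra|lra].
- have := pos (- x) (- y); rewrite mulrNN opprK (mulNr x y) -(mulrN x y).
  rewrite (_ : - x + y = - (x - y)) ?normrN; last by ring.
  move=> /(_ ltac:(lra) ltac:(lra)).
  by rewrite (@ler0_norm _ (x + y)); [lra|lra].
Qed.

(** Reweighting by an increasing function of [|S a|] does not lower the mean of [|S a|]. *)
Lemma block_coshR (h : R) : 0 <= h ->
  A * (\sum_a W a * coshR (h * `|S a|)) <= \sum_a W a * (coshR (h * `|S a|) * `|S a|).
Proof.
move=> h0; rewrite /A mulrAC ler_pdivrMr// [leRHS]mulrC.
rewrite [X in _ <= _ * X](eq_bigr (fun a => W a * `|S a| * coshR (h * `|S a|))).
  2: by move=> a _; ring.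
apply: chebyshev_sum => // a b; have [ab|/ltW ba] := leP `|S a| `|S b|.
  by rewrite mulr_le0 ?subr_le0// coshR_le ?mulr_ge0// ler_wpM2l.
by rewrite mulr_ge0 ?subr_ge0// coshR_le ?mulr_ge0// ler_wpM2l.
Qed.

(* Flipping the second block symmetrizes the interaction [expR (k^2 S a S b)]
   into [coshR (k^2 |S a| |S b|)], which favours large [|S a|] and [|S b|]; the
   loss [2 min(|S a|, |S b|)] on opposite signs costs at most [1/k]. *)
Lemma block_step (k : R) : 0 < k ->
  (2 * A - k^-1) *
    (\sum_a \sum_b W a * W b * expR (k ^+ 2 * (S a * S b))) <=
  \sum_a \sum_b W a * W b * expR (k ^+ 2 * (S a * S b)) * `|S a + S b|.
Proof.
move=> k0.
pose C a b := coshR (k ^+ 2 * (`|S a| * `|S b|)).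
have ZE : \sum_a \sum_b W a * W b * expR (k ^+ 2 * (S a * S b)) =
    \sum_a \sum_b W a * W b * C a b.
  apply: eq_bigr => a _.
  under eq_bigr do rewrite -mulrA.
  under [RHS]eq_bigr do rewrite -mulrA.
  rewrite -!mulr_sumr; congr (_ * _).
  rewrite (block_symm (fun s => expR (k ^+ 2 * (S a * s)))).
  apply: eq_bigr => b _; rewrite /C.
  have -> : k ^+ 2 * (`|S a| * `|S b|) = `|k ^+ 2 * (S a * S b)|.
    by rewrite !normrM (gtr0_norm k0).
  by rewrite coshR_norm /coshR !mulrN.
have AE : \sum_a \sum_b W a * W b * expR (k ^+ 2 * (S a * S b)) * `|S a + S b| =
    \sum_a \sum_b W a * W b * ((expR (k ^+ 2 * (S a * S b)) * `|S a + S b| +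
      expR (k ^+ 2 * (S a * - S b)) * `|S a - S b|) / 2).
  apply: eq_bigr => a _.
  under eq_bigr do rewrite -mulrA -mulrA.
  under [RHS]eq_bigr do rewrite -mulrA.
  rewrite -!mulr_sumr; congr (_ * _).
  exact: (block_symm (fun s => expR (k ^+ 2 * (S a * s)) * `|S a + s|)).
rewrite {}AE ZE.
apply: (@le_trans _ _ (\sum_a \sum_b W a * W b *
    (C a b * (`|S a| + `|S b|) - k^-1))); last first.
  apply: ler_sum => a _; apply: ler_sum => b _; apply: ler_wpM2l; first exact: mulr_ge0.
  exact: coshR_sum_norm.
(* For each fixed [a] this is [block_coshR] in the variable [b], with field k^2 |S a|. *)
have hA : A * (\sum_a \sum_b W a * W b * C a b) <=
    \sum_a \sum_b W a * W b * (C a b * `|S b|).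
  rewrite mulr_sumr; apply: ler_sum => a _.
  under eq_bigr do rewrite -mulrA.
  under [leRHS]eq_bigr do rewrite -mulrA.
  rewrite -!mulr_sumr mulrCA; apply: ler_wpM2l => //.
  have := @block_coshR (k ^+ 2 * `|S a|); rewrite mulr_ge0 ?sqr_ge0// => /(_ isT).
  rewrite /C; under eq_bigr do rewrite -mulrA.
  by under [X in _ <= X -> _]eq_bigr do rewrite -mulrA.
have hA' : \sum_a \sum_b W a * W b * (C a b * `|S a|) =
    \sum_a \sum_b W a * W b * (C a b * `|S b|).
  rewrite exchange_big; apply: eq_bigr => a _; apply: eq_bigr => b _.
  by rewrite /C (mulrC (W b)) (mulrC `|S b|).
(* The loss was weighted without the interaction; [coshR_ge1] bounds it by the interacting partition
   function. *)
have hk : k^-1 * (\sum_a \sum_b W a * W b) <=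
    k^-1 * (\sum_a \sum_b W a * W b * C a b).
  apply: ler_wpM2l; first by rewrite invr_ge0 ltW.
  apply: ler_sum => a _; apply: ler_sum => b _; rewrite ler_peMr ?mulr_ge0//.
  exact: coshR_ge1.
have -> : \sum_a \sum_b W a * W b * (C a b * (`|S a| + `|S b|) - k^-1) =
    \sum_a \sum_b W a * W b * (C a b * `|S a|) +
    \sum_a \sum_b W a * W b * (C a b * `|S b|) - k^-1 * \sum_a \sum_b W a * W b.
  rewrite mulr_sumr -big_split -sumrB; apply: eq_bigr => a _.
  by rewrite mulr_sumr -big_split -sumrB; apply: eq_bigr => b _ /=; ring.
rewrite hA'; lra.
Qed.

(** Symmetrizing turns exp(h S) S into sinh(h |S|) |S| = cosh(h |S|) |S| - exp(-h |S|) |S|. The last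
    term is at most 1/h, and the cosh reweighting does not lower the mean of |S|. *)
Lemma block_field (h : R) : 0 < h ->
  (A - h^-1) * (\sum_a W a * expR (h * S a)) <=
  \sum_a W a * (expR (h * S a) * S a).
Proof.
move=> h0.
have cE s : (expR (h * s) + expR (h * - s)) / 2 = coshR (h * `|s|).
  by rewrite -[in RHS](gtr0_norm h0) -normrM coshR_norm /coshR mulrN.
rewrite (block_symm (fun s => expR (h * s))).
rewrite (block_symm (fun s => expR (h * s) * s)).
under eq_bigr do rewrite cE.
have h1 := block_coshR (ltW h0).
apply: (@le_trans _ _ (\sum_a W a * (coshR (h * `|S a|) * `|S a| - h^-1))).
  under [leRHS]eq_bigr do rewrite mulrBr.
  rewrite sumrB -mulr_suml mulrBl; apply: lerB => //.
  rewrite mulrC; apply: ler_wpM2l; first by rewrite invr_ge0 ltW.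
  apply: ler_sum => a _; rewrite ler_peMr//; exact: coshR_ge1.
apply: ler_sum => a _; apply: ler_wpM2l => //.
have le x : 0 <= x -> x * expR (- (h * x)) <= h^-1.
  move=> x0; rewrite expRN ler_pdivrMr ?expR_gt0// mulrC ler_pdivlMr// mulrC.
  by apply: le_trans (expR_ge1Dx _); lra.
have := le _ (normr_ge0 (S a)); rewrite /coshR.
case: (ger0P (S a)) => _; rewrite ?opprK !mulrN ?opprK;
  set e := expR _; set e' := expR _; lra.
Qed.

End block.

(** * Spin windows, pair energies and the hierarchical Hamiltonian *)

Section windows.
Context {R : realType}.

Lemma spin_eqb (b c : bool) : spin (b == c) = spin b * spin c :> R.
Proof. by case: b; case: c; rewrite /spin /= ?mulr1 ?mul1r ?mulrN1 ?opprK. Qed.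

Lemma spin_negb (b : bool) : spin (~~ b) = - spin b :> R.
Proof. by case: b; rewrite /spin /= ?opprK. Qed.

Lemma spin_sqr (b : bool) : spin b ^+ 2 = 1 :> R.
Proof. by case: b; rewrite /spin ?sqrrN expr1n. Qed.

Lemma normr_spin (b : bool) : `|spin b| = 1 :> R.
Proof. by case: b; rewrite /spin ?normrN normr1. Qed.

(** Sitewise multiplication of spins: with [true] standing for 1, equality of booleans is the
    product. *)
Definition wmul m (s t : window m) : window m := [ffun i => s i == t i].
Definition wflip m (s : window m) : window m := [ffun i => ~~ s i].
Definition wlo m n (s : window (m + n)) : window m := [ffun i => s (lshift n i)].
Definition whi m n (s : window (m + n)) : window n := [ffun i => s (rshift m i)].

Lemma wmulI m (s : window m) : injective (wmul s).
Proof.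
move=> t u /ffunP e; apply/ffunP => i; move: (e i); rewrite !ffunE.
by case: (s i); case: (t i); case: (u i).
Qed.

Lemma wflipK m : involutive (@wflip m).
Proof. by move=> s; apply/ffunP => i; rewrite !ffunE negbK. Qed.

Lemma window_split m n (F : window m -> window n -> R) :
  \sum_(s : window (m + n)) F (wlo s) (whi s) = \sum_a \sum_b F a b.
Proof.
rewrite pair_big /=.
pose g (c : window m * window n) : window (m + n) :=
  [ffun t => match fintype.split t with inl i => c.1 i | inr j => c.2 j end].
have gK1 c : wlo (g c) = c.1.
  apply/ffunP => i; rewrite !ffunE.
  by have := unsplitK (inl i : 'I_m + 'I_n); rewrite /unsplit /= => ->.
have gK2 c : whi (g c) = c.2.
  apply/ffunP => i; rewrite !ffunE.
  by have := unsplitK (inr i : 'I_m + 'I_n); rewrite /unsplit /= => ->.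
rewrite (reindex g) /=.
  by apply: eq_bigr => c _; rewrite gK1 gK2.
apply: onW_bij; exists (fun s => (wlo s, whi s)) => [c|s].
  by rewrite gK1 gK2; case: c.
apply/ffunP => t; rewrite ffunE -[in RHS](splitK t); case: (fintype.split t) => i /=;
  by rewrite ffunE.
Qed.

Lemma character_spin m (i : 'I_m) :
  character (@wmul m) (fun s => spin (s i) : R).
Proof. by split=> [s t|s]; rewrite ?ffunE ?spin_eqb ?spin_sqr. Qed.

Lemma ferro_comp m n (f : window n -> window m) (F : window m -> R) :
  (forall s t, f (wmul s t) = wmul (f s) (f t)) ->
  ferro (@wmul m) F -> ferro (@wmul n) (F \o f).
Proof.
move=> fM; elim=> [|c chi {}F c0 [cM c2] hF IH]; first exact: ferro0.
apply: (ferro_cons (chi := chi \o f)) => //; split=> [s t|s] //=.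
by rewrite fM cM.
Qed.

Lemma wloM m n (s t : window (m + n)) : wlo (wmul s t) = wmul (wlo s) (wlo t).
Proof. by apply/ffunP => i; rewrite !ffunE. Qed.

Lemma whiM m n (s t : window (m + n)) : whi (wmul s t) = wmul (whi s) (whi t).
Proof. by apply/ffunP => i; rewrite !ffunE. Qed.

Definition mag m (s : window m) : R := \sum_i spin (s i).

Lemma mag_flip m (s : window m) : mag (wflip s) = - mag s.
Proof. by rewrite -sumrN; apply: eq_bigr => i _; rewrite ffunE spin_negb. Qed.

Lemma mag_split m n (s : window (m + n)) : mag s = mag (wlo s) + mag (whi s).
Proof.
by rewrite /mag big_split_ord; congr (_ + _); apply: eq_bigr => i _; rewrite ffunE.
Qed.

Definition pairEnergy (J : nat -> R) m (s : window m) : R :=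
  \sum_(i < m) \sum_(j < m | (i < j)%N) J (j - i)%N * (spin (s i) * spin (s j)).

Lemma pairEnergy_split J m n (s : window (m + n)) :
  pairEnergy J s = pairEnergy J (wlo s) + pairEnergy J (whi s) +
  \sum_(i < m) \sum_(j < n) J (m + j - i)%N * (spin (wlo s i) * spin (whi s j)).
Proof.
rewrite /pairEnergy big_split_ord /= addrAC; congr (_ + _).
  rewrite -big_split; apply: eq_bigr => i _; rewrite big_split_ord /=.
  congr (_ + _); first by apply: eq_bigr => j _; rewrite !ffunE.
  apply: eq_big => j; last by rewrite !ffunE.
  by rewrite ltn_addr.
apply: eq_bigr => i _; rewrite big_split_ord /= big1 ?add0r.
  apply: eq_big => j; first by rewrite ltn_add2l.
  by rewrite subnDl !ffunE.
move=> j ij; exfalso; move: ij; have := ltn_ord j; lia.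
Qed.

(** Powers of two by doubling, so that [window (sz n.+1)] is convertible to [window (sz n + sz n)]
    and splits into halves without casts. *)
Fixpoint sz N : nat := if N is n.+1 then (sz n + sz n)%N else 1%N.

Lemma szE N : sz N = (2 ^ N)%N.
Proof. by elim: N => //= n ->; rewrite expnS mul2n addnn. Qed.

Lemma sz_gt0 N : (0 < sz N)%N.
Proof. by rewrite szE expn_gt0. Qed.

Definition site0 N : 'I_(sz N) := Ordinal (sz_gt0 N).

(** Dyson's hierarchical Hamiltonian with the sign absorbed. The couplings are written as squares
    because the loss in [block_step] is the inverse of their square root. *)
Fixpoint hier (k : nat -> R) N : window (sz N) -> R :=
  match N return window (sz N) -> R with
  | 0 => fun=> 0
  | n.+1 => fun s : window (sz n + sz n) => hier k (wlo s) + hier k (whi s)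
                + k n.+1 ^+ 2 * (mag (wlo s) * mag (whi s))
  end.

Lemma ferro_block m n (c : 'I_m -> 'I_n -> R) : (forall i j, 0 <= c i j) ->
  ferro (@wmul (m + n)) (fun s => \sum_i \sum_j
    c i j * (spin (wlo s i) * spin (whi s j))).
Proof.
move=> c0; apply: ferro_sum => i _; apply: ferro_sum => j _.
apply: ferro_char => //; apply: characterM.
  by split=> [s t|s]; rewrite ?spin_sqr// !ffunE spin_eqb.
by split=> [s t|s]; rewrite ?spin_sqr// !ffunE spin_eqb.
Qed.

Lemma magM_sum m n (a : window m) (b : window n) :
  mag a * mag b = \sum_i \sum_j spin (a i) * spin (b j).
Proof. by rewrite /mag big_distrlr. Qed.

Lemma ferro_hier k N : ferro (@wmul (sz N)) (hier k (N := N)).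
Proof.
elim: N => [|N IH]; first exact: ferro0.
apply: ferroD; first apply: ferroD.
- exact: (ferro_comp (@wloM _ _) IH).
- exact: (ferro_comp (@whiM _ _) IH).
- rewrite [X in ferro _ X](_ : _ = fun s : window (sz N + sz N) => \sum_i \sum_j
    k N.+1 ^+ 2 * (spin (wlo s i) * spin (whi s j))).
    by apply: ferro_block => i j; exact: sqr_ge0.
  apply/funext => s; rewrite magM_sum mulr_sumr; apply: eq_bigr => i _.
  by rewrite mulr_sumr.
Qed.

(** Two sites in different halves of a block of size 2^n are at distance d with 0 < d < 2^n, and
    [hier] couples them by [k n ^+ 2], so the hypothesis makes every remaining coupling
    nonnegative. *)
Lemma ferro_pairEnergy_hier J k N :
  (forall n d, (0 < d < 2 ^ n)%N -> k n ^+ 2 <= J d) ->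
  ferro (@wmul (sz N)) (fun s => pairEnergy J s - hier k s).
Proof.
move=> kJ; elim: N => [|N IH].
  rewrite [X in ferro _ X](_ : _ = fun=> 0); first exact: ferro0.
  apply/funext => s; rewrite /= subr0 /pairEnergy big1// => i _.
  by rewrite big1// => j; rewrite !ord1.
rewrite [X in ferro _ X](_ : _ = fun s : window (sz N + sz N) =>
  (pairEnergy J (wlo s) - hier k (wlo s)) +
  (pairEnergy J (whi s) - hier k (whi s)) +
  \sum_(i < sz N) \sum_(j < sz N)
    (J (sz N + j - i)%N - k N.+1 ^+ 2) * (spin (wlo s i) * spin (whi s j))).
  apply: ferroD; first apply: ferroD.
  - exact: (ferro_comp (@wloM _ _) IH).
  - exact: (ferro_comp (@whiM _ _) IH).
  - apply: (@ferro_block (sz N) (sz N)) => i j; rewrite subr_ge0; apply: kJ.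
    have iN : (i < sz N)%N := ltn_ord i; have jN : (j < sz N)%N := ltn_ord j.
    by rewrite expnS -szE; lia.
apply/funext => s; rewrite pairEnergy_split /= magM_sum mulr_sumr.
under [in RHS]eq_bigr do under eq_bigr do rewrite mulrBl.
under [in RHS]eq_bigr do rewrite sumrB -mulr_sumr.
rewrite sumrB; ring.
Qed.

Section hierarchical_magnetization.
Variables (k : nat -> R) (e r : R).
Hypotheses (k0 : forall n, 0 < k n) (e0 : 0 <= e) (r01 : 0 <= r < 1).
(** The loss at level n, relative to the block size 2^n, is at most e r^n and hence summable. *)
Hypothesis ker : forall n, (k n)^-1 <= e * (2 * r) ^+ n.

Let W N (s : window (sz N)) := expR (hier k s).
Let Z N := \sum_s @W N s.

Lemma hier_flip N (s : window (sz N)) : hier k (wflip s) = hier k s.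
Proof.
elim: N s => //= N IH s.
have e1 : wlo (wflip s : window (sz N + sz N)) = wflip (wlo s).
  by apply/ffunP => i; rewrite !ffunE.
have e2 : whi (wflip s : window (sz N + sz N)) = wflip (whi s).
  by apply/ffunP => i; rewrite !ffunE.
by rewrite e1 e2 !IH !mag_flip mulrNN.
Qed.

Lemma hier_sum N (F : R -> R) : \sum_(s : window (sz N.+1)) W s * F (mag s) =
  \sum_(a : window (sz N)) \sum_(b : window (sz N))
    W a * W b * expR (k N.+1 ^+ 2 * (mag a * mag b)) * F (mag a + mag b).
Proof.
rewrite -window_split; apply: eq_bigr => s _.
by rewrite /W /= !expRD (@mag_split (sz N) (sz N)).
Qed.

Definition hierMag N := (\sum_s @W N s * `|mag s|) / Z N.

Let Z_gt0 N : 0 < Z N.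
Proof. exact: sum_expR_gt0 [ffun=> true]. Qed.

Lemma hierMag_step N : 2 * hierMag N - (k N.+1)^-1 <= hierMag N.+1.
Proof.
have Z1 : Z N.+1 = \sum_(a : window (sz N)) \sum_(b : window (sz N))
    W a * W b * expR (k N.+1 ^+ 2 * (mag a * mag b)).
  transitivity (\sum_(s : window (sz N.+1)) W s * 1).
    by apply: eq_bigr => s _; rewrite mulr1.
  rewrite (hier_sum _ (fun=> 1)).
  by apply: eq_bigr => a _; apply: eq_bigr => b _; rewrite mulr1.
rewrite /hierMag ler_pdivlMr// Z1 (hier_sum _ (fun x => `|x|)).
apply: (@block_step R (window (sz N)) (@W N) (@mag _) (@wflip _)) => //.
- by move=> a; exact: expR_ge0.
- exact: Z_gt0.
- exact: (can_inj (@wflipK _)).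
- by move=> a; rewrite /W hier_flip.
- exact: mag_flip.
Qed.

Lemma hierMag_ge N : (2 ^+ N) * (1 - e * (1 - r)^-1) <= hierMag N.
Proof.
case/andP: r01 => r0 r1.
(* The induction carries the partial geometric sum (1 - r^N)/(1 - r), which is 0 for a single spin.
   In [kN] the factor r^(N+1) is weakened to r^N so that the step adds exactly the next term. *)
suff h : (2 ^+ N) * (1 - e * (1 - r)^-1 * (1 - r ^+ N)) <= hierMag N.
  apply: le_trans h; rewrite ler_pM2l ?exprn_gt0// lerD2l lerN2 ler_piMr//.
    by rewrite mulr_ge0// invr_ge0 subr_ge0 ltW.
  by rewrite gerBl exprn_ge0.
elim: N => [|N IH].
  rewrite !expr0 subrr mulr0 subr0 mul1r /hierMag /Z /W /=.
  rewrite ler_pdivlMr ?(Z_gt0 0)// mul1r; apply: ler_sum => s _.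
  by rewrite expR0 mul1r /mag big_ord1 normr_spin.
have kN : (k N.+1)^-1 <= e * (2 ^+ N.+1 * r ^+ N).
  apply: le_trans (ker _) _; rewrite exprMn ler_wpM2l// ler_wpM2l ?exprn_ge0//.
  by rewrite ler_wiXn2l// ltW.
apply: le_trans (hierMag_step N); apply: le_trans (lerB (ler_wpM2l _ IH) kN) => //.
rewrite !exprS le_eqVlt; apply/orP; left; apply/eqP.
by field; rewrite subr_eq0 gt_eqF.
Qed.

(* By exchangeability of the sites under the symmetries of the binary tree;
   the induction needs an arbitrary function of the magnetization. *)
Lemma hier_site0 N (F : R -> R) :
  2 ^+ N * (\sum_s @W N s * (spin (s (site0 N)) * F (mag s))) =
  \sum_s @W N s * (mag s * F (mag s)).
Proof.
elim: N F => [|N IH] F.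
  rewrite expr0 mul1r; apply: eq_bigr => s _; rewrite /mag big_ord1.
  by congr (_ * (spin (s _) * _)); apply: val_inj.
rewrite (hier_sum _ (fun x => x * F x)).
pose G (a b : window (sz N)) :=
  W a * W b * expR (k N.+1 ^+ 2 * (mag a * mag b)) * F (mag a + mag b).
(* The left side reaches this form by induction on the half containing [site0]; the right side does
   because [G] is symmetric in the two halves. *)
transitivity (2 * \sum_a \sum_b G a b * mag a).
  rewrite exprS -mulrA; congr (_ * _).
  rewrite (eq_bigr (fun s : window (sz N + sz N) =>
    G (wlo s) (whi s) * spin (wlo s (site0 N)))); last first.
    move=> s _; rewrite /G {1}/W /= !expRD (@mag_split (sz N) (sz N)) ffunE.
    rewrite (_ : site0 N.+1 = lshift (sz N) (site0 N)); last exact: val_inj.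
    by rewrite /W; ring.
  rewrite (window_split (fun a b => G a b * spin (a (site0 N)))).
  rewrite [X in _ * X = _]exchange_big [RHS]exchange_big mulr_sumr.
  apply: eq_bigr => b _.
  (* With [b] frozen, the interaction between the halves depends on [a] only through [mag a], so it
     becomes part of the arbitrary function. *)
  have := IH (fun x => W b * expR (k N.+1 ^+ 2 * (x * mag b)) * F (x + mag b)).
  rewrite [X in _ * X = _](eq_bigr (fun a => G a b * spin (a (site0 N)))); last first.
    by move=> a _; rewrite /G; ring.
  by move=> ->; apply: eq_bigr => a _; rewrite /G; ring.
rewrite mulr_natl mulr2n [X in X + _]exchange_big -big_split.
apply: eq_bigr => a _; rewrite -big_split; apply: eq_bigr => b _ /=.
by rewrite /G (mulrC (mag b)) (addrC (mag b)); ring.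
Qed.

(** [block_field] bounds the total magnetization from below, and [hier_site0] identifies the share
    of [site0] as one part in 2^N. *)
Lemma hier_field N (h : R) : 0 < h ->
  1 - e * (1 - r)^-1 - (h * 2 ^+ N)^-1 <=
  gibbs_mean (fun s : window (sz N) => hier k s + h * mag s)
    (fun s => spin (s (site0 N))).
Proof.
move=> h0; rewrite /gibbs_mean ler_pdivlMr ?(sum_expR_gt0 _ [ffun=> true])//.
have p2 : 0 < 2 ^+ N :> R by exact: exprn_gt0.
rewrite -(ler_pM2l p2) mulrA.
have -> : 2 ^+ N * (\sum_(s : window (sz N)) spin (s (site0 N)) *
    expR (hier k s + h * mag s)) = \sum_s @W N s * (expR (h * mag s) * mag s).
  under eq_bigr do rewrite expRD mulrCA.
  rewrite (hier_site0 _ (fun x => expR (h * x))).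
  by apply: eq_bigr => s _; rewrite (mulrC (mag s)).
under [X in _ * X <= _]eq_bigr do rewrite expRD.
apply: le_trans (@block_field R (window (sz N)) (@W N) (@mag _) (@wflip _)
   _ _ _ _ _ h h0).
- apply: ler_wpM2r; first by apply: sumr_ge0 => s _; rewrite mulr_ge0 ?expR_ge0.
  rewrite mulrBr invfM mulrCA divff ?gt_eqF// mulr1 lerB//.
  exact: hierMag_ge.
- by move=> a; exact: expR_ge0.
- exact: Z_gt0.
- exact: (can_inj (@wflipK _)).
- by move=> a; rewrite /W hier_flip.
- exact: mag_flip.
Qed.

(** The Hamiltonian exceeds the hierarchical one in the constant field [h] by a ferromagnetic term,
    so Griffiths monotonicity transfers [hier_field]. *)
Lemma ising_field_magnetization (J : nat -> R) N (hh : 'I_(sz N) -> R) (h : R) :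
  (forall n d, (0 < d < 2 ^ n)%N -> k n ^+ 2 <= J d) ->
  0 < h -> (forall i, h <= hh i) ->
  1 - e * (1 - r)^-1 - (h * 2 ^+ N)^-1 <=
  gibbs_mean (fun s : window (sz N) => pairEnergy J s + \sum_i hh i * spin (s i))
    (fun s => spin (s (site0 N))).
Proof.
move=> kJ h0 hhh; apply: le_trans (hier_field N h0) _.
have fm : ferro (@wmul (sz N)) (fun s => h * mag s).
  rewrite [X in ferro _ X](_ : _ = fun s : window (sz N) => \sum_i h * spin (s i)).
    apply: ferro_sum => i _; apply: ferro_char; first exact: ltW.
    exact: character_spin.
  by apply/funext => s; rewrite mulr_sumr.
have fd : ferro (@wmul (sz N)) (fun s => (pairEnergy J s - hier k s) +
    \sum_i (hh i - h) * spin (s i)).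
  apply: ferroD; first exact: ferro_pairEnergy_hier.
  apply: ferro_sum => i _; apply: ferro_char; first by rewrite subr_ge0.
  exact: character_spin.
have := gibbs_mean_mono (@wmulI (sz N)) [ffun=> true]
  (ferroD (@ferro_hier k N) fm) fd (character_spin (site0 N)).
set G := (X in gibbs_mean X _); set G' := (X in _ <= gibbs_mean X _).
rewrite [X in _ -> _ <= gibbs_mean X _](_ : _ = G')//; apply/funext => s; rewrite /G'.
under [in RHS]eq_bigr do rewrite mulrBl.
by rewrite sumrB -mulr_sumr /mag; ring.
Qed.

End hierarchical_magnetization.
End windows.

(** * Power-law interactions *)

Section power_decay.
Context {R : realType}.

Definition pw (a : R) (n : nat) : R := n%:R `^ (- a).

Lemma pw_ge0 a n : 0 <= pw a n.
Proof. exact: powR_ge0. Qed.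

Lemma pw1 a : pw a 1 = 1.
Proof. by rewrite /pw powR1. Qed.

Lemma pw_le a m n : 0 <= a -> (0 < m <= n)%N -> pw a n <= pw a m.
Proof.
move=> a0 /andP[m0 mn]; rewrite /pw !powRN lef_pV2 ?posrE ?powR_gt0 ?ltr0n//.
  by rewrite ge0_ler_powR ?nnegrE ?ler_nat.
exact: leq_trans mn.
Qed.

(** Integral comparison in discrete form: ((n+1)/n)^a >= 1 + a ln((n+1)/n) >= 1 + a/(n+1), the last
    step being ln x <= x - 1 at x = n/(n+1). *)
Lemma pw_telescope a n : 0 < a -> (0 < n)%N ->
  a * pw (a + 1) n.+1 <= pw a n - pw a n.+1.
Proof.
move=> a0 n0.
have n0' : 0 < n%:R :> R by rewrite ltr0n.
have n1' : 0 < n.+1%:R :> R by rewrite ltr0n.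
have pE : pw (a + 1) n.+1 = pw a n.+1 / n.+1%:R.
  rewrite /pw opprD powRD ?powR_inv1 ?ltW//.
  by rewrite (gt_eqF n1') implybT.
have -> : pw a n = pw a n.+1 * (n.+1%:R / n%:R) `^ a.
  rewrite /pw powRM ?ltW// ?invr_gt0// (powRN n.+1%:R) mulrA mulVf ?mul1r; last first.
    by rewrite gt_eqF ?powR_gt0.
  by rewrite -powR_inv1 ?ltW// -powRrM mulN1r.
rewrite pE mulrCA -[X in _ - X]mulr1 -mulrBr ler_wpM2l ?pw_ge0//.
rewrite lerBrDl /powR gt_eqF ?divr_gt0//.
apply: le_trans (expR_ge1Dx _); rewrite lerD2l ler_wpM2l ?(ltW a0)//.
have := @le_ln1Dx R (n%:R / n.+1%:R - 1).
have x0 : 0 < n%:R / n.+1%:R :> R by rewrite divr_gt0.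
rewrite (addrC 1) subrK ltrBrDr addNr => /(_ x0) h.
rewrite -[n.+1%:R / n%:R]invrK invf_div lnV ?posrE//.
apply: le_trans (_ : _ <= - (n%:R / n.+1%:R - 1)) _; last by rewrite lerN2.
rewrite -natr1 le_eqVlt; apply/orP; left; apply/eqP.
by field; rewrite natr1 gt_eqF.
Qed.

Lemma pw_tail_sum a c N : 0 < a -> (0 < c)%N ->
  \sum_(0 <= n < N | (c <= n.+1)%N) pw (a + 1) n.+1 <= (1 + a^-1) * pw a c.
Proof.
move=> a0 c0.
have le1 : pw (a + 1) c <= pw a c.
  have c1 : 1 <= c%:R :> R by rewrite ler1n.
  by rewrite /pw ler_powR//; lra.
(* The first term is kept apart; the later ones telescope, which is why the induction retains
   [- pw a N]. *)
suff : \sum_(0 <= n < N | (c <= n.+1)%N) pw (a + 1) n.+1 <=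
    if (c <= N)%N then pw (a + 1) c + a^-1 * (pw a c - pw a N) else 0.
  move=> h; apply: le_trans h _; have ai : 0 < a^-1 by rewrite invr_gt0.
  have := pw_ge0 a c; have := pw_ge0 a N; case: ifP => _; nra.
elim: N => [|N IH]; first by rewrite big_geq// leqn0 gtn_eqF.
rewrite big_mkcond big_nat_recr//= -big_mkcond /=.
have [cN|cN] := leqP c N.+1; last first.
  by rewrite addr0; apply: le_trans IH _; rewrite leqNgt (ltnW cN).
have [cN'|cN'] := leqP c N.
  rewrite cN' in IH; apply: le_trans (lerD IH (lexx _)) _.
  have := @pw_telescope a N a0 (leq_trans c0 cN') => h.
  have : pw (a + 1) N.+1 <= a^-1 * (pw a N - pw a N.+1).
    by rewrite ler_pdivlMl.
  lra.
have cE : c = N.+1 by apply/eqP; rewrite eqn_leq cN.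
rewrite cE ltnn in IH *.
by rewrite subrr mulr0 addr0 -[leRHS]add0r lerD2r.
Qed.

Lemma cvg_pw_series p : 1 < p -> cvgn (series (fun n => pw p n.+1)).
Proof.
move=> p1; apply: nondecreasing_is_cvgn.
  by apply/nondecreasing_seqP => n; rewrite /series /= big_nat_recr//= lerDl pw_ge0.
exists (1 + (p - 1)^-1) => _ [N _ <-].
have := @pw_tail_sum (p - 1) 1 N; rewrite subr_gt0 p1 subrK pw1 mulr1.
by move=> /(_ isT isT); apply: le_trans; rewrite /series /= le_eqVlt eqxx.
Qed.

End power_decay.

(** * The interaction of a spin with its past *)

Section chain_field.
Context {R : realType} (p : R) (p1 : 1 < p).

Lemma cvg_pw_bounded (c : nat -> R) : (forall n, `|c n| <= 1) ->
  cvgn (series (fun n => pw p n.+1 * c n)).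
Proof.
move=> c1; apply: normed_cvg.
apply: (@series_le_cvg _ (fun n => `|pw p n.+1 * c n|) (fun n => pw p n.+1)).
- by move=> n.
- by move=> n; exact: pw_ge0.
- by move=> n; rewrite normrM ger0_norm ?pw_ge0// ler_piMr ?pw_ge0.
- exact: cvg_pw_series.
Qed.

(** Larger indices are farther in the past, so every bond is counted once, at its right end [t]. *)
Definition chainField (x : nat -> bool) (t : nat) : R :=
  limn (series (fun n => pw p n.+1 * (spin (x t) * spin (x (t + n.+1)%N)))).

Lemma normr_spinM (b c : bool) : `|spin b * spin c : R| <= 1.
Proof. by rewrite normrM !normr_spin mulr1. Qed.

Lemma cvg_chainField x t :
  cvgn (series (fun n => pw p n.+1 * (spin (x t) * spin (x (t + n.+1)%N) : R))).
Proof. by apply: cvg_pw_bounded => n; exact: normr_spinM. Qed.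

Lemma chainField_ext x x' t : (forall u, (t <= u)%N -> x u = x' u) ->
  chainField x t = chainField x' t.
Proof.
move=> xx'; rewrite /chainField; congr (limn (series _)); apply/funext => n.
by rewrite !xx'// leq_addr.
Qed.

Lemma chainField_flip x t : chainField (fun u => ~~ x u) t = chainField x t.
Proof.
rewrite /chainField; congr (limn (series _)); apply/funext => n.
by rewrite !spin_negb mulrNN.
Qed.

(** Only bonds of length at least [k - t] see the change, each by at most twice its coupling;
    [pw_tail_sum] bounds their sum. *)
Lemma chainField_diff x x' k t : (forall u, (u < k)%N -> x u = x' u) -> (t < k)%N ->
  `|chainField x t - chainField x' t| <=
  2 * (1 + (p - 1)^-1) * pw (p - 1) (k - t)%N.
Proof.
move=> xx' tk.
have h0 := cvg_norm (cvgB (@cvg_chainField x t) (@cvg_chainField x' t)).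
apply: (cvgr_to_le (h0 _ _)).
near=> N; rewrite !fctE /series /= -sumrB.
have ap : 0 < p - 1 by rewrite subr_gt0.
have := @pw_tail_sum _ (p - 1) (k - t)%N N ap; rewrite subn_gt0 tk subrK => /(_ isT) h.
rewrite -mulrA; apply: le_trans (ler_wpM2l _ h) => //.
apply: le_trans (ler_norm_sum _ _ _) _.
rewrite mulr_sumr [leRHS]big_mkcond; apply: ler_sum => n _.
have [kn|kn] := leqP.
  rewrite -mulrBr normrM ger0_norm ?pw_ge0// mulrC ler_wpM2r ?pw_ge0//.
  apply: le_trans (ler_normB _ _) _.
  by rewrite (_ : 2 = 1 + 1 :> R)// lerD ?normr_spinM.
by rewrite !xx' ?subrr ?normr0//; lia.
Unshelve. all: by end_near. Qed.

(** The field exerted on site [t] by plus spins at all sites from [m] on. *)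
Definition boundaryField m t : R :=
  limn (series (fun n => if (m <= t + n.+1)%N then pw p n.+1 else 0)).

Lemma cvg_boundaryField m t :
  cvgn (series (fun n => if (m <= t + n.+1)%N then pw p n.+1 else 0 : R)).
Proof.
have := @cvg_pw_bounded (fun n => (m <= t + n.+1)%N%:R).
rewrite (_ : (fun n => _ * _) = fun n => if (m <= t + n.+1)%N then pw p n.+1 else 0).
  by apply=> n; case: (_ <= _)%N; rewrite ?normr1 ?normr0.
by apply/funext => n; case: (_ <= _)%N; rewrite ?mulr1 ?mulr0.
Qed.

(** The m terms with m <= n < 2m reach the boundary whatever t is, and each is at least (2m)^-p. *)
Lemma boundaryField_ge m t : (0 < m)%N ->
  m%:R * pw p (m + m)%N <= boundaryField m t.
Proof.
move=> m0; apply: limr_ge; first exact: cvg_boundaryField.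
near=> N; rewrite /series /=.
have mN : (m + m <= N)%N by near: N; exact: nbhs_infty_ge.
rewrite (@big_cat_nat _ _ _ (m + m)%N)//= (@big_cat_nat _ _ _ m)//=; last exact: leq_addr.
have s0 i j : 0 <= \sum_(i <= n < j)
    (if (m <= t + n.+1)%N then pw p n.+1 else 0 : R).
  by apply: sumr_ge0 => n _; case: ifP; rewrite ?pw_ge0.
rewrite addrAC ler_wpDl ?addr_ge0//.
apply: (@le_trans _ _ (\sum_(m <= n < m + m) pw p (m + m)%N)).
  by rewrite sumr_const_nat addnK mulr_natl.
rewrite !big_nat; apply: ler_sum => n /andP[mn nm].
rewrite ifT; last by lia.
by apply: pw_le; [apply: ltW; apply: lt_trans p1|lia].
Unshelve. all: by end_near. Qed.

Lemma chainField_window m (x : nat -> bool) b t : (t < m)%N ->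
  (forall u, (m <= u)%N -> x u = b) ->
  chainField x t =
  \sum_(j < m | (t < j)%N) pw p (j - t)%N * (spin (x t) * spin (x j)) +
  boundaryField m t * (spin b * spin (x t)).
Proof.
move=> tm xb; apply/cvg_lim => //.
set A := (X in _ --> X + _).
have h : (fun N => A + series (fun n => if (m <= t + n.+1)%N then pw p n.+1 else 0) N
    * (spin b * spin (x t))) @ \oo --> A + boundaryField m t * (spin b * spin (x t)).
  by apply: cvgD; [exact: cvg_cst|
    apply: cvgM; [exact: cvg_boundaryField|exact: cvg_cst]].
apply: cvg_trans h; apply: near_eq_cvg; near=> N.
have mN : (m <= N)%N by near: N; exact: nbhs_infty_ge.
rewrite /series /=.
have -> : A = \sum_(0 <= n < N) if (m <= t + n.+1)%N then 0 else
    pw p n.+1 * (spin (x t) * spin (x (t + n.+1)%N)).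
  rewrite /A -(big_mkord (fun j => t < j)%N
    (fun j => pw p (j - t)%N * (spin (x t) * spin (x j)))).
  rewrite (@big_cat_nat _ _ _ t.+1)//= big1_seq ?add0r; last first.
    by move=> j /andP[tj]; rewrite mem_index_iota; lia.
  rewrite -{1}[t.+1]add0n big_addn.
  have mt : (m - t.+1 <= N)%N by lia.
  rewrite [RHS](@big_cat_nat _ _ _ (m - t.+1)%N)//= -[LHS]addr0; congr (_ + _).
    rewrite big_mkcond; apply: eq_big_nat => n nm.
    rewrite ifT ?ifF; [|lia|lia].
    have -> : (n + t.+1 - t = n.+1)%N by lia.
    by have -> : (n + t.+1 = t + n.+1)%N by lia.
  rewrite big_nat big1// => n nm; rewrite ifT//; lia.
rewrite mulr_suml -big_split; apply: eq_bigr => n _ /=.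
case: ifP => [mn|_]; last by rewrite mul0r addr0.
by rewrite add0r (xb (t + n.+1)%N)// [spin b * _]mulrC. 
Unshelve. all: by end_near. Qed.

End chain_field.

(** * Sites and bonds numbered from the right end *)

Definition st (t : nat) : L := exist _ (- t%:Z) (etrans (oppr_le0 _) (lez_nat 0 t)).

Lemma site_st t : site (st t) = - t%:Z.
Proof. by []. Qed.

Lemma absz_st t : `|site (st t)|%N = t.
Proof. by rewrite site_st abszN. Qed.

Lemma st_absz (i : L) : st `|site i|%N = i.
Proof.
by apply: site_inj; rewrite site_st abszE ler0_norm ?opprK// site_le0.
Qed.

Lemma st_inj : injective st.
Proof. by move=> t u /(congr1 (fun i => `|site i|%N)); rewrite !absz_st. Qed.

(* Configurations are read from the right end: index t stands for the site -t. *)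
Definition conf (w : Omega) : nat -> bool := fun t => w (st t).

(** Lists every two-element set of sites exactly once, by its right end and its length minus one. *)
Definition bond (k : nat * nat) : {fset L} := [fset st k.1; st (k.1 + k.2.+1)%N]%fset.

Lemma bond_inj : injective bond.
Proof.
move=> [t n] [u m] /fsetP e.
have := e (st t); have := e (st u); have := e (st (t + n.+1)%N).
have := e (st (u + m.+1)%N).
rewrite /bond !inE /= !(inj_eq st_inj) !eqxx /= ?orbT.
move=> /orP h1 /esym/orP h2 /orP h3 /esym/orP h4.
have tu : t = u.
  by case: h1 => /eqP; case: h2 => /eqP; case: h3 => /eqP; case: h4 => /eqP; lia.
by congr pair => //; case: h1 => /eqP; case: h2 => /eqP; lia.
Qed.

Lemma bondP (A : {fset L}) : #|` A| = 2 -> exists k, A = bond k.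
Proof.
move=> A2; have := fset_uniq A.
have : forall x, x \in A = (x \in enum_fset A) by [].
move: A2; case: (enum_fset A) => [|x [|y []]]//= _ hA.
rewrite !inE andbT => xy.
wlog ltyx : x y xy hA / (`|site x| < `|site y|)%N => [h|].
  have [lt|lt|e] := ltngtP `|site x|%N `|site y|%N; first exact: (h x y).
    apply: (h y x) => //; first by rewrite eq_sym.
    by move=> z; rewrite hA !inE orbC.
  by move: xy; rewrite -(st_absz x) -(st_absz y) e eqxx.
exists (`|site x|, (`|site y| - `|site x|).-1)%N; apply/fsetP => z.
rewrite hA /bond !inE /= st_absz.
have -> : (`|site x| + (`|site y| - `|site x|).-1.+1 = `|site y|)%N by lia.
by rewrite st_absz.
Qed.

Lemma meeting_bond (i : L) k : meeting i (bond k) <-> (k.1 < `|site i|.+1)%N.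
Proof.
rewrite /meeting /=; split=> [[j]|h].
  rewrite /bond !inE -(st_absz i) => /orP[]/eqP ->; rewrite !site_st abszN; lia.
exists (st k.1); first by rewrite /bond !inE eqxx.
by rewrite -(st_absz i) !site_st; lia.
Qed.

(** * The Ising energy as a convergent series *)

Section energy_series.
Context {R : realType}.

(** Only bonds contribute, and a bond meets [i, 0] exactly when its right end lies there. *)
Lemma esum_meeting (i : L) (a : {fset L} -> \bar R) : (forall A, 0 <= a A)%E ->
  (forall A, #|` A| != 2%N -> a A = 0%E) ->
  (\esum_(A in meeting i) a A =
   \sum_(t < `|site i|.+1) \sum_(0 <= n <oo) a (bond (t : nat, n)))%E.
Proof.
move=> a0 aN.
pose e (k : 'I_(`|site i|.+1) * nat) := bond (k.1 : nat, k.2).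
have -> : (\esum_(A in meeting i) a A = \esum_(A in e @` setT) a A)%E.
  rewrite esum_mkcond [RHS]esum_mkcond; apply: eq_esum => A _.
  have [A2|A2] := eqVneq #|` A| 2%N; last by rewrite aN//; do 2!case: ifP.
  congr (if _ then _ else _); have [k ->] := bondP A2.
  apply/idP/idP; rewrite !inE.
    by move=> /meeting_bond h; exists (Ordinal h, k.2) => //; case: k {A2} h.
  move=> [[t n] _ /= h].
  by apply/meeting_bond; move/bond_inj: h => <- /=.
rewrite esum_image; last first.
  move=> [t n] [u m] _ _ /bond_inj[tu ->]; congr pair; exact: val_inj.
rewrite [X in esum X _](_ : _ = setT `*`` (fun=> setT)); last first.
  by apply/seteqP; split.
rewrite -(@esum_esum _ _ _ setT (fun=> setT) (fun t n => a (e (t, n))))//.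
rewrite esum_fset; [|exact: finite_finset|by move=> t _; apply: esum_ge0].
rewrite (_ : [set: 'I_(`|site i|.+1)] = [set` index_enum 'I_(`|site i|.+1)]); last first.
  by apply/seteqP; split => t //= _; rewrite mem_index_enum.
rewrite -fsbig_seq ?index_enum_uniq//; apply: eq_bigr => t _.
by rewrite nneseries_esumT.
Qed.

Lemma nneseries_EFin (v : nat -> R) : cvgn (series v) ->
  (\sum_(0 <= n <oo) (v n)%:E = (limn (series v))%:E)%E.
Proof.
move=> cv; rewrite -EFin_lim//; congr (limn _); apply/funext => n.
by rewrite /series /= sumEFin.
Qed.

(** Links [usum], a difference of sums of positive and negative parts, to the ordinary limit:
    absolute convergence keeps both parts finite. *)
Lemma eseries_posneg (u : nat -> R) : cvgn (series (fun n => `|u n|)) ->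
  exists a b : R, [/\ (\sum_(0 <= n <oo) (EFin \o u)^\+ n = a%:E)%E,
    (\sum_(0 <= n <oo) (EFin \o u)^\- n = b%:E)%E & a - b = limn (series u)].
Proof.
move=> cu.
have cmax (v : nat -> R) : (forall n, `|v n| = `|u n|) ->
    cvgn (series (fun n => Num.max (v n) 0)).
  move=> vu; apply: series_le_cvg cu => n.
  - by rewrite le_max lexx orbT.
  - by [].
  - by rewrite -vu ge_max ler_norm normr_ge0.
have cp := cmax u (fun=> erefl); have cn := cmax (\- u) (fun n => normrN _).
exists (limn (series (fun n => Num.max (u n) 0))),
  (limn (series (fun n => Num.max (- u n) 0))); split.
- rewrite -nneseries_EFin//; congr (limn _); apply/funext => N.
  by apply: eq_bigr => n _; rewrite funeposE /= EFin_max.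
- rewrite -nneseries_EFin//; congr (limn _); apply/funext => N.
  by apply: eq_bigr => n _; rewrite funenegE /= EFin_max.
- apply/esym/cvg_lim => //.
  rewrite (_ : series u = fun N => series (fun n => Num.max (u n) 0) N -
      series (fun n => Num.max (- u n) 0) N); first exact: cvgB.
  apply/funext => N; rewrite /series /= -sumrB; apply: eq_bigr => n _.
  by case: (leP (u n) 0) => h; case: (leP (- u n) 0) => h'; lra.
Qed.

Lemma powerCoupling_st (p : R) t n :
  powerCoupling p (st t) (st (t + n.+1)%N) = pw p n.+1.
Proof.
rewrite /powerCoupling /pw !site_st.
have -> : `|- t%:Z - - (t + n.+1)%N%:Z| = n.+1%:Z.
  by rewrite opprK PoszD addrA addNr add0r.
by [].
Qed.

Lemma powerCouplingC (p : R) i j : powerCoupling p i j = powerCoupling p j i.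
Proof. by rewrite /powerCoupling distrC. Qed.

Lemma isingPotential_bond (beta p : R) t n w :
  isingPotential beta (powerCoupling p) (bond (t, n)) w =
  - beta * (pw p n.+1 * (spin (conf w t) * spin (conf w (t + n.+1)%N))).
Proof.
rewrite /bond isingPotential_pair /=.
- by rewrite powerCoupling_st /conf !mulrA.
- exact: powerCouplingC.
- by rewrite (inj_eq st_inj); apply/eqP; lia.
Qed.

Lemma energyE (beta p : R) (i : L) (w : Omega) : 1 < p ->
  energy (isingPotential beta (powerCoupling p)) i w =
  - beta * \sum_(t < `|site i|.+1) chainField p (conf w) t.
Proof.
move=> p1; rewrite /energy /usum.
set a := EFin \o _.
have aN A : #|` A| != 2%N -> a A = 0%E.
  by move=> A2; rewrite /a /= /isingPotential (negbTE A2).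
rewrite (@esum_meeting i a^\+%E); first last.
- by move=> A /aN aA; rewrite funeposE aA maxxx.
- by move=> A; exact: funepos_ge0.
rewrite (@esum_meeting i a^\-%E); first last.
- by move=> A /aN aA; rewrite funenegE aA oppe0 maxxx.
- by move=> A; exact: funeneg_ge0.
pose u t n := - beta * (pw p n.+1 * (spin (conf w t) * spin (conf w (t + n.+1)%N))).
have cu t : cvgn (series (u t)).
  rewrite /u (_ : series _ = fun N => - beta * series (fun n => pw p n.+1 *
    (spin (conf w t) * spin (conf w (t + n.+1)%N))) N).
    by apply: is_cvgM; [exact: is_cvg_cst|exact: cvg_chainField].
  by apply/funext => N; rewrite /series /= mulr_sumr.
have cau t : cvgn (series (fun n => `|u t n|)).
  rewrite (_ : series _ = fun N => `|beta| * series (fun n => pw p n.+1) N).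
    by apply: is_cvgM; [exact: is_cvg_cst|exact: cvg_pw_series].
  apply/funext => N; rewrite /series /= mulr_sumr; apply: eq_bigr => n _.
  by rewrite /u !normrM normrN !normr_spin !mulr1 (ger0_norm (pw_ge0 _ _)).
have hex t : exists b : R * R,
    [/\ (\sum_(0 <= n <oo) (EFin \o u t)^\+ n = b.1%:E)%E,
    (\sum_(0 <= n <oo) (EFin \o u t)^\- n = b.2%:E)%E & b.1 - b.2 = limn (series (u t))].
  by have [b [c h]] := eseries_posneg (cau t); exists (b, c).
pose b t := projT1 (cid (hex t)); have hb t := projT2 (cid (hex t)).
have -> : (\sum_(t < `|site i|.+1) \sum_(0 <= n <oo) a^\+ (bond (t : nat, n)) =
    (\sum_(t < `|site i|.+1) (b t).1)%:E)%E.
  rewrite -sumEFin; apply: eq_bigr => t _; have [<- _ _] := hb t.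
  apply: congr_lim; apply/funext => N; apply: eq_bigr => n _.
  by rewrite !funeposE /a /= isingPotential_bond.
have -> : (\sum_(t < `|site i|.+1) \sum_(0 <= n <oo) a^\- (bond (t : nat, n)) =
    (\sum_(t < `|site i|.+1) (b t).2)%:E)%E.
  rewrite -sumEFin; apply: eq_bigr => t _; have [_ <- _] := hb t.
  apply: congr_lim; apply/funext => N; apply: eq_bigr => n _.
  by rewrite !funenegE /a /= isingPotential_bond.
rewrite -EFinB /= -sumrB mulr_sumr; apply: eq_bigr => t _.
have [_ _ ->] := hb t; apply/cvg_lim => //.
rewrite (_ : series _ = fun N => - beta * series (fun n => pw p n.+1 *
  (spin (conf w t) * spin (conf w (t + n.+1)%N))) N).
  by apply: cvgM; [exact: cvg_cst|exact: cvg_chainField].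
by apply/funext => N; rewrite /series /= mulr_sumr.
Qed.

End energy_series.

(** * Chains as limits of finite-volume expectations *)

(* [word n x] is [:: x (n-1); ...; x 0]. A consistent family of word
   probabilities is realized on [0, 1[ with Lebesgue measure by the quantile
   map: the words l of length n correspond to the disjoint intervals
   [cumul l, cumul l + nu l[. *)
Section word_law.
Context {R : realType} (nu : seq bool -> R).
Hypotheses (nu0 : forall l, 0 <= nu l) (nu1 : nu [::] = 1)
  (nuD : forall l, nu l = nu (true :: l) + nu (false :: l)).

Fixpoint word n (x : nat -> bool) : seq bool :=
  if n is m.+1 then x m :: word m x else [::].

Fixpoint cumul (l : seq bool) : R :=
  if l is b :: l' then (if b then cumul l' else cumul l' + nu (true :: l')) else 0.

Fixpoint quantileWord n (u : R) : seq bool :=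
  if n is m.+1 then
    let l := quantileWord m u in (u < cumul l + nu (true :: l)) :: l
  else [::].

Definition quantile (u : R) : Omega :=
  fun j => head true (quantileWord `|site j|.+1 u).

Lemma size_quantileWord n u : size (quantileWord n u) = n.
Proof. by elim: n => //= n ->. Qed.

Lemma word_quantile n u : word n (conf (quantile u)) = quantileWord n u.
Proof.
elim: n => //= n ->; congr cons.
by rewrite /conf /quantile absz_st.
Qed.

(** By [nuD] the interval of [l] splits into that of [true :: l] on the left and that of
    [false :: l] on the right; the next letter records the side on which [u] lies. *)
Lemma quantileWordE n u l : 0 <= u < 1 -> size l = n ->
  quantileWord n u = l <-> cumul l <= u < cumul l + nu l.
Proof.
move=> u01; elim: n l => [|n IH] [|b l]//= => [_|[sl]].
  by rewrite nu1 add0r.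
have {}IH := IH l sl; split.
  move=> [h lE]; have := IH.1 lE; move: h; rewrite lE => <-.
  rewrite [nu l]nuD addrA => /andP[h1 h2].
  have [h|h] := ltP; first by rewrite h1 h.
  by rewrite h h2.
move=> h; have lE : quantileWord n u = l.
  apply: IH.2; rewrite [nu l]nuD addrA.
  have := nu0 (true :: l); have := nu0 (false :: l).
  by case: b h => /andP[h1 h2] h3 h4; apply/andP; split; lra.
rewrite lE; congr cons; case: b h => /andP[h1 h2]; first by rewrite h2.
by rewrite ltNge h1.
Qed.

Lemma measurable_quantileWord n l : measurable [set u : R | quantileWord n u = l].
Proof.
elim: n l => [|n IH] l.
  have [->|lN] := eqVneq l [::].
    by rewrite (_ : mkset _ = setT)//; apply/seteqP; split.
  rewrite (_ : mkset _ = set0)//; apply/seteqP; split => // u /= lE.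
  by move: lN; rewrite -lE.
case: l => [|b l].
  by rewrite (_ : mkset _ = set0)//; apply/seteqP; split.
have mlt (c : R) : measurable [set u : R | u < c].
  rewrite (_ : mkset _ = [set` `]-oo, c[]); first exact: measurable_itv.
  by rewrite set_itvE.
rewrite (_ : mkset _ = [set u | quantileWord n u = l] `&`
    (if b then [set u | u < cumul l + nu (true :: l)]
     else ~` [set u | u < cumul l + nu (true :: l)])).
  by apply: measurableI => //; case: b => //; exact: measurableC.
apply/seteqP; split => u /=.
  move=> [bE lE]; split => //; move: bE; rewrite lE; case: b => //= h /=.
  by rewrite h.
move=> [-> h]; congr cons; case: b h => //= h.
by apply/negP.
Qed.

Lemma measurable_quantile : measurable_fun setT (quantile : R -> OmegaF).
Proof.
apply: measurable_Omega => j _ _ B _; rewrite setTI.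
rewrite (_ : _ @^-1` _ = \bigcup_(t in [set t : (`|site j|.+1).-tuple bool |
    B (head true t)]) [set u | quantileWord `|site j|.+1 u = t]).
  by apply: fin_bigcup_measurable => [|t _]; [exact: finite_finset|
    exact: measurable_quantileWord].
apply/seteqP; split => [u /= Bu|u [t]]; last first.
  by rewrite /mkset => Bt uE; rewrite /preimage /= /quantile uE.
exists (Tuple (introT eqP (size_quantileWord `|site j|.+1 u))) => //.
Qed.

Definition wordLaw (A : set OmegaF) : \bar R :=
  mrestr lebesgue_measure (measurable_itv `[0 : R, 1[) (quantile @^-1` A).

Let wordLaw_set0 : wordLaw set0 = 0%E.
Proof. by rewrite /wordLaw preimage_set0 measure0. Qed.

Let wordLaw_ge0 A : (0 <= wordLaw A)%E.
Proof. exact: measure_ge0. Qed.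

Let wordLaw_sigma_additive : semi_sigma_additive wordLaw.
Proof.
move=> F mF tF mUF; rewrite /wordLaw preimage_bigcup.
apply: measure_semi_sigma_additive.
- by move=> n; rewrite -[X in measurable X]setTI; exact: measurable_quantile.
- apply/trivIsetP => /= i j _ _ ij; rewrite -preimage_setI.
  by move/trivIsetP : tF => /(_ _ _ _ _ ij) ->//; rewrite preimage_set0.
- by rewrite -preimage_bigcup -[X in measurable X]setTI; exact: measurable_quantile.
Qed.

HB.instance Definition _ := isMeasure.Build _ OmegaF _
  wordLaw wordLaw_set0 wordLaw_ge0 wordLaw_sigma_additive.

Let wordLaw_setT : wordLaw setT = 1%E.
Proof.
rewrite /wordLaw preimage_setT /mrestr setTI lebesgue_measure_itv /= lte_fin ltr01.
by rewrite -EFinB subr0.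
Qed.

HB.instance Definition _ := Measure_isProbability.Build _ OmegaF _ wordLaw wordLaw_setT.

Lemma cumul_bounds l : 0 <= cumul l /\ cumul l + nu l <= 1.
Proof.
elim: l => [|b l [h1 h2]]; first by rewrite nu1 /= add0r.
have := nuD l; have := nu0 (true :: l); have := nu0 (false :: l).
by case: b => /=; split; lra.
Qed.

Lemma wordLaw_word l : wordLaw [set w | word (size l) (conf w) = l] = (nu l)%:E.
Proof.
rewrite /wordLaw /mrestr.
have [c0 c1] := cumul_bounds l.
rewrite (_ : _ `&` _ = [set` `[cumul l, cumul l + nu l[]).
  rewrite lebesgue_measure_itv /= lte_fin ltrDl.
  have [_|n0] := ltP 0; first by rewrite -EFinB addrAC subrr add0r.
  by congr EFin; apply/eqP; rewrite eq_le n0 nu0.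
apply/seteqP; split => u /=.
  move=> []; rewrite word_quantile in_itv /= => uE u01.
  by rewrite in_itv /=; apply/quantileWordE.
rewrite in_itv /= => h; have u01 : 0 <= u < 1.
  by case/andP: h => h1 h2; apply/andP; split; lra.
by rewrite in_itv; split => //; rewrite word_quantile; apply/(quantileWordE u01).
Qed.

End word_law.

Lemma word_extension (R : realType) (nu : seq bool -> R) :
  (forall l, 0 <= nu l) -> nu [::] = 1 ->
  (forall l, nu l = nu (true :: l) + nu (false :: l)) ->
  exists mu : probability OmegaF R,
    forall l, mu [set w | word (size l) (conf w) = l] = (nu l)%:E.
Proof.
by move=> nu0 nu1 nuD; exists (wordLaw nu) => l; exact: wordLaw_word.
Qed.

Lemma word_ext k (x y : nat -> bool) : (forall t, (t < k)%N -> x t = y t) ->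
  word k x = word k y.
Proof.
elim: k => //= k IH xy; rewrite xy// IH// => t tk; apply: xy.
exact: ltnW.
Qed.

Lemma word_inj k (x y : nat -> bool) : word k x = word k y ->
  forall t, (t < k)%N -> x t = y t.
Proof.
elim: k => //= k IH [xk wk] t; rewrite ltnS leq_eqVlt => /orP[/eqP -> //|].
exact: IH.
Qed.

Lemma size_word k x : size (word k x) = k.
Proof. by elim: k => //= k ->. Qed.

(** A configuration whose word of length [size l] is [l]. Beyond that length the truncated
    subtraction repeats the head of [l]. *)
Definition wordConf (l : seq bool) : Omega :=
  fun j => nth true l (size l - `|site j|.+1).

Lemma conf_wordConf l : word (size l) (conf (wordConf l)) = l.
Proof.
suff h : word (size l) (fun t => nth true l (size l - t.+1)) = l.
  rewrite -[RHS]h; apply: word_ext => t _.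
  by rewrite /conf /wordConf absz_st.
elim: l => //= b l IH; rewrite subnn; congr cons.
rewrite -[RHS]IH; apply: word_ext => t tl.
by rewrite subSn.
Qed.

Lemma measurable_word k l : measurable ([set w | word k (conf w) = l] : set OmegaF).
Proof.
elim: k l => [|k IH] l.
  have [->|lN] := eqVneq l [::].
    by rewrite (_ : mkset _ = setT)//; apply/seteqP; split.
  rewrite (_ : mkset _ = set0)//; apply/seteqP; split => // u /= lE.
  by move: lN; rewrite -lE.
case: l => [|b l].
  by rewrite (_ : mkset _ = set0)//; apply/seteqP; split.
rewrite (_ : mkset _ = [set w | word k (conf w) = l] `&`
    (fun w : Omega => w (st k)) @^-1` [set b]).
  by apply: measurableI; [exact: IH|exact: coordSets_measurable].
apply/seteqP; split => w /= [h1 h2]; first by split.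
by rewrite h1 /conf h2.
Qed.

(** * Ultrafilter limits of expectations and the measures representing them *)

Section functional_limit.
Context {R : realType} (U : set_system nat) {UU : UltraFilter U}.

(** Compactness of [-C, C] yields a cluster point, and an ultrafilter converges to each of its
    cluster points. *)
Lemma ultra_bounded_cvg (u : nat -> R) C : (forall n, `|u n| <= C) ->
  cvg (u @ U).
Proof.
move=> uC; have FU : ProperFilter (u @ U) by exact: fmap_proper_filter.
have UC : (u @ U) [set` `[- C, C]].
  by apply: nearW => n; rewrite /= in_itv /= -ler_norml.
have [x [_ clx]] := @segment_compact R (- C) C (u @ U) FU UC.
apply/cvg_ex; exists x => V Vx.
have [//|nV] := in_ultra_setVsetC (u @^-1` V) UU.
have [y [nVy Vy]] := clx (~` V) V nV Vx.
by [].
Qed.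

Variable E : nat -> (Omega -> R) -> R.
Hypotheses (ED : forall n F G, E n (fun w => F w + G w) = E n F + E n G)
  (EZ : forall n c F, E n (fun w => c * F w) = c * E n F)
  (E_ge0 : forall n F, (forall w, 0 <= F w) -> 0 <= E n F)
  (E1 : forall n, E n (fun=> 1) = 1).

Lemma E_le n F G : (forall w, F w <= G w) -> E n F <= E n G.
Proof.
move=> FG; rewrite -subr_ge0 -mulN1r -EZ -ED; apply: E_ge0 => w.
by rewrite mulN1r subr_ge0.
Qed.

Lemma E_bounded n F C : (forall w, `|F w| <= C) -> `|E n F| <= C.
Proof.
move=> FC; have Ec c : E n (fun=> c) = c.
  by rewrite -[in LHS](mulr1 c) EZ E1 mulr1.
rewrite ler_norml -{1}(Ec (- C)) -{2}(Ec C); apply/andP.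
by split; apply: E_le => w; have := FC w; rewrite ler_norml => /andP[].
Qed.

(** Along an ultrafilter all bounded observables converge at once, without extracting a
    subsequence. *)
Definition limE (F : Omega -> R) : R := lim ((fun n => E n F) @ U).

Definition bounded_obs (F : Omega -> R) := exists C, forall w, `|F w| <= C.

Lemma cvg_limE F : bounded_obs F -> (fun n => E n F) @ U --> limE F.
Proof.
by move=> [C FC]; apply: (@ultra_bounded_cvg _ C) => n; exact: E_bounded.
Qed.

Lemma limED F G : bounded_obs F -> bounded_obs G ->
  limE (fun w => F w + G w) = limE F + limE G.
Proof.
move=> bF bG; apply/cvg_lim => //.
rewrite (_ : (fun n => _) = fun n => E n F + E n G); last first.
  by apply/funext => n; rewrite ED.
by apply: cvgD; exact: cvg_limE.
Qed.

Lemma limEZ c F : bounded_obs F -> limE (fun w => c * F w) = c * limE F.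
Proof.
move=> bF; apply/cvg_lim => //.
rewrite (_ : (fun n => _) = fun n => c * E n F); last first.
  by apply/funext => n; rewrite EZ.
by apply: cvgM; [exact: cvg_cst|exact: cvg_limE].
Qed.

Lemma limE_cst c : limE (fun=> c) = c.
Proof.
apply/cvg_lim => //; rewrite (_ : (fun n => _) = fun=> c); first exact: cvg_cst.
by apply/funext => n; rewrite -[in LHS](mulr1 c) EZ E1 mulr1.
Qed.

Lemma limE_le F G : bounded_obs F -> bounded_obs G ->
  (forall w, F w <= G w) -> limE F <= limE G.
Proof.
move=> bF bG FG; apply: (ler_cvg_to (cvg_limE bF) (cvg_limE bG)).
by apply: nearW => n; exact: E_le.
Qed.

Lemma limE_near F G : bounded_obs F -> bounded_obs G ->
  U [set n | E n F = E n G] -> limE F = limE G.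
Proof.
move=> bF bG UFG; apply/eqP; rewrite eq_le; apply/andP; split.
  apply: (ler_cvg_to (cvg_limE bF) (cvg_limE bG)).
  by apply: filterS UFG => n /= ->.
apply: (ler_cvg_to (cvg_limE bG) (cvg_limE bF)).
by apply: filterS UFG => n /= ->.
Qed.

Lemma bounded_obsD F G : bounded_obs F -> bounded_obs G ->
  bounded_obs (fun w => F w + G w).
Proof.
move=> [C FC] [D GD]; exists (C + D) => w.
by apply: le_trans (ler_normD _ _) _; rewrite lerD.
Qed.

Lemma bounded_obsZ c F : bounded_obs F -> bounded_obs (fun w => c * F w).
Proof. by move=> [C FC]; exists (`|c| * C) => w; rewrite normrM ler_wpM2l. Qed.

Lemma bounded_obs_cst c : bounded_obs (fun=> c).
Proof. by exists `|c|. Qed.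

Definition cyl (l : seq bool) (w : Omega) : R := (word (size l) (conf w) == l)%:R.

Lemma bounded_cyl l : bounded_obs (cyl l).
Proof. by exists 1 => w; rewrite /cyl; case: eqP; rewrite ?normr1 ?normr0. Qed.

Lemma limE_sum (T : Type) (s : seq T) (c : T -> R) (G : T -> Omega -> R) :
  (forall i, bounded_obs (G i)) ->
  bounded_obs (fun w => \sum_(i <- s) c i * G i w) /\
  limE (fun w => \sum_(i <- s) c i * G i w) = \sum_(i <- s) c i * limE (G i).
Proof.
move=> bG; elim: s => [|i s [IHb IH]].
  rewrite (_ : (fun w => _) = fun=> 0); last by apply/funext => w; rewrite big_nil.
  by rewrite big_nil limE_cst; split => //; exact: bounded_obs_cst.
rewrite (_ : (fun w => _) = fun w => c i * G i w + \sum_(i <- s) c i * G i w).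
  rewrite big_cons limED// ?limEZ ?IH//; last exact: bounded_obsZ.
  by split => //; apply: bounded_obsD => //; exact: bounded_obsZ.
by apply/funext => w; rewrite big_cons.
Qed.

Definition quasilocal (F : Omega -> R) := forall e, 0 < e -> exists k,
  forall w w', word k (conf w) = word k (conf w') -> `|F w - F w'| <= e.

(** The limits on cylinders form a consistent family of word probabilities, which [word_extension]
    turns into a measure. Uniform approximation by finite combinations of cylinders extends the
    equality to quasilocal functions. *)
Lemma functional_representation : exists mu : probability OmegaF R,
  forall F, measurable_fun setT (F : OmegaF -> R) -> (forall w, 0 <= F w <= 1) ->
    quasilocal F -> (\int[mu]_w (F w)%:E)%E = (limE F)%:E.
Proof.
have [] := @word_extension R (fun l => limE (cyl l)).
- move=> l; rewrite -(limE_cst 0); apply: limE_le.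
  + exact: bounded_obs_cst.
  + exact: bounded_cyl.
  + by move=> w; rewrite /cyl ler0n.
- by rewrite -[RHS](limE_cst 1); congr limE; apply/funext => w.
- move=> l; rewrite -limED; try exact: bounded_cyl.
  congr limE; apply/funext => w; rewrite /cyl /= !eqseq_cons.
  by case: (conf w (size l)); case: (_ == l); rewrite /= ?addr0 ?add0r.
move=> mu muE; exists mu => F mF F01 qF.
(* [Fk] sees only the last [k] spins, so it is a finite combination of cylinders. *)
have approx_local k : exists2 Fk : Omega -> R,
    (forall w, Fk w = F (wordConf (word k (conf w)))) &
    [/\ bounded_obs Fk, measurable_fun setT (Fk : OmegaF -> R) &
      (\int[mu]_w (Fk w)%:E)%E = (limE Fk)%:E].
  pose c (l : k.-tuple bool) := F (wordConf l).
  exists (fun w => \sum_(l <- index_enum {: k.-tuple bool}) c l * cyl l w).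
    move=> w; pose l0 : k.-tuple bool := Tuple (introT eqP (size_word k (conf w))).
    rewrite (bigD1 l0)//= big1 ?addr0 => [|l ll0].
      by rewrite /cyl /= size_word eqxx mulr1.
    rewrite /cyl size_tuple; case: eqP => [lE|]; last by rewrite mulr0.
    by case/eqP: ll0; apply/val_inj/esym.
  have [bs ->] := @limE_sum _ (index_enum {: k.-tuple bool}) c cyl bounded_cyl.
  have ml l : measurable ([set w | word (size l) (conf w) = l] : set OmegaF).
    exact: measurable_word.
  have cylE l w : cyl l w = \1_[set w | word (size l) (conf w) = l] w.
    by rewrite indicE /cyl; congr (_%:R); congr nat_of_bool; apply/eqP/idP;
      rewrite inE.
  have mcyl l : measurable_fun setT (cyl l : OmegaF -> R).
    rewrite (_ : cyl l = \1_[set w | word (size l) (conf w) = l]).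
      exact: measurable_indic.
    by apply/funext => w; rewrite cylE.
  split => //.
    by apply: measurable_sum => l; apply: measurable_funM.
  under eq_integral do rewrite -sumEFin.
  rewrite ge0_integral_sum//; first last.
  - by move=> l w _; rewrite lee_fin mulr_ge0 ?ler0n//; case/andP: (F01 (wordConf l)).
  - by move=> l; apply/measurable_EFinP; apply: measurable_funM.
  rewrite -sumEFin; apply: eq_bigr => l _.
  under eq_integral do rewrite EFinM.
  rewrite ge0_integralZl_EFin//; first last.
  - by case/andP: (F01 (wordConf l)).
  - by apply/measurable_EFinP.
  - by move=> w _; rewrite lee_fin ler0n.
  under eq_integral do rewrite cylE.
  by rewrite integral_indic// setIT EFinM -muE.
have bF : bounded_obs F.
  by exists 1 => w; case/andP: (F01 w) => F0 F1; rewrite ger0_norm.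
(* Replacing [F] by [Fk] costs at most [e] in the integral and at most [e] in the limit. *)
have approx e : 0 < e -> (\int[mu]_w (F w)%:E <= (limE F + (e + e))%:E)%E /\
    ((limE F)%:E <= \int[mu]_w (F w)%:E + (e + e)%:E)%E.
  move=> e0; have [N hN] := qF e e0; have [Fk FkE [bFk mFk iFk]] := approx_local N.
  have Fk01 w : 0 <= Fk w <= 1 by rewrite FkE.
  have near w : `|F w - Fk w| <= e.
    by rewrite FkE; apply: hN; rewrite -{2}(size_word N (conf w)) conf_wordConf.
  have l1 : limE Fk <= limE F + e.
    rewrite -[e in leRHS]limE_cst -limED//; last exact: bounded_obs_cst.
    apply: limE_le => //; first by apply: bounded_obsD => //; exact: bounded_obs_cst.
    by move=> w; have := near w; rewrite ler_norml => /andP[]; lra.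
  have l2 : limE F <= limE Fk + e.
    rewrite -[e in leRHS]limE_cst -limED//; last exact: bounded_obs_cst.
    apply: limE_le => //; first by apply: bounded_obsD => //; exact: bounded_obs_cst.
    by move=> w; have := near w; rewrite ler_norml => /andP[]; lra.
  have intD (G : Omega -> R) : measurable_fun setT (G : OmegaF -> R) ->
      (forall w, 0 <= G w) ->
      (\int[mu]_w (G w + e)%:E = \int[mu]_w (G w)%:E + e%:E)%E.
    move=> mG G0; under eq_integral do rewrite EFinD.
    rewrite ge0_integralD//.
    - by rewrite integral_cst// [X in (_ * X)%E](probability_setT mu) mule1.
    - by move=> w _; rewrite lee_fin.
    - exact/measurable_EFinP.
    - by move=> w _; rewrite lee_fin ltW.
  have int_le (G H : Omega -> R) : measurable_fun setT (G : OmegaF -> R) ->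
      measurable_fun setT (H : OmegaF -> R) -> (forall w, 0 <= G w <= H w) ->
      (\int[mu]_w (G w)%:E <= \int[mu]_w (H w)%:E)%E.
    move=> mG mH GH; apply: ge0_le_integral => //.
    - by move=> w _; rewrite lee_fin; case/andP: (GH w).
    - exact/measurable_EFinP.
    - exact/measurable_EFinP.
    - by move=> w _; rewrite lee_fin; case/andP: (GH w).
  split.
    apply: (@le_trans _ _ (\int[mu]_w (Fk w + e)%:E)%E).
      apply: int_le => //; first exact: measurable_funD.
      move=> w; case/andP: (F01 w) => -> _ /=.
      by have := near w; rewrite ler_norml => /andP[]; lra.
    rewrite intD// => [|w]; last by case/andP: (Fk01 w).
    by rewrite iFk -EFinD lee_fin; lra.
  apply: (@le_trans _ _ (\int[mu]_w (F w + e)%:E + e%:E)%E).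
    apply: (@le_trans _ _ (\int[mu]_w (Fk w)%:E + e%:E)%E).
      by rewrite iFk -EFinD lee_fin.
    apply: leeD => //; apply: int_le => //; first exact: measurable_funD.
    move=> w; case/andP: (Fk01 w) => -> _ /=.
    by have := near w; rewrite ler_norml => /andP[]; lra.
  rewrite intD// => [|w]; last by case/andP: (F01 w).
  by rewrite -addeA -EFinD.
apply/eqP; rewrite eq_le; apply/andP; split; apply/lee_addgt0Pr => e e0;
  have [h1 h2] := approx (e / 2) (divr_gt0 e0 (ltr0Sn _ 1)).
  by rewrite -EFinD; move: h1; rewrite -splitr.
by move: h2; rewrite -splitr.
Qed.

End functional_limit.

(** * Consistency of Gibbs measures with the Ising LSS *)

Lemma conf_inj w w' : (forall t, conf w t = conf w' t) -> w = w'.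
Proof. by move=> ww'; apply/funext => j; rewrite -(st_absz j); exact: ww'. Qed.

Lemma conf_concat_lt m (s : window m) w (t : 'I_m) : conf (concat s w) t = s t.
Proof.
rewrite /conf /concat absz_st; case: insubP => [u _ ut|]; last by rewrite ltn_ord.
by congr (s _); exact: val_inj.
Qed.

Lemma conf_concat_ge m (s : window m) w t : (m <= t)%N -> conf (concat s w) t = conf w t.
Proof.
by move=> mt; rewrite /conf /concat absz_st; case: insubP => // u; rewrite ltnNge mt.
Qed.

Lemma conf_update (i : L) b w t :
  conf (update i b w) t = if t == `|site i|%N then b else conf w t.
Proof.
rewrite /conf /update -{1}(st_absz i) (inj_eq st_inj); case: eqP => // ti.
Qed.

Lemma concat_ext m (s : window m) w w' :
  (forall t, (m <= t)%N -> conf w t = conf w' t) -> concat s w = concat s w'.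
Proof.
move=> ww'; apply: conf_inj => t; have [tm|mt] := ltnP t m.
  by rewrite -[t]/(nat_of_ord (Ordinal tm)) !conf_concat_lt.
by rewrite !conf_concat_ge// ww'.
Qed.

Lemma window_update (R : realType) (i : L) w (F : Omega -> R) :
  \sum_(tau : window `|site i|.+1) F (concat tau w) =
  \sum_b \sum_(tau : window `|site i|) F (concat tau (update i b w)).
Proof.
rewrite pair_big /=; set n := `|site i|%N.
pose h (c : bool * window n) : window n.+1 :=
  [ffun t => if unlift ord_max t is Some u then c.2 u else c.1].
pose g (c : window n.+1) : bool * window n :=
  (c ord_max, [ffun u => c (lift ord_max u)]).
have hK : cancel h g.
  move=> [s c]; rewrite /g /h ffunE unlift_none; congr pair.
  by apply/ffunP => u; rewrite !ffunE liftK.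
have gK : cancel g h.
  move=> c; apply/ffunP => t; rewrite /h ffunE.
  by case: unliftP => [u|] -> //; rewrite ffunE.
rewrite (reindex h); last by apply: onW_bij; exists g.
apply: eq_bigr => -[b c] _ /=; congr (F _); apply: conf_inj => t.
have [tn|] := ltnP t n.
  rewrite -[t in RHS]/(nat_of_ord (Ordinal tn)) conf_concat_lt.
  have tn' : (t < n.+1)%N by exact: ltnW.
  rewrite -[t in LHS]/(nat_of_ord (Ordinal tn')) conf_concat_lt ffunE.
  rewrite (_ : Ordinal tn' = lift ord_max (Ordinal tn)) ?liftK//.
  by apply: val_inj; rewrite /= /bump leqNgt tn.
rewrite leq_eqVlt => /orP[/eqP <-|nt].
  rewrite [RHS]conf_concat_ge// conf_update eqxx.
  by rewrite -[n in LHS]/(nat_of_ord (@ord_max n)) conf_concat_lt ffunE unlift_none.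
rewrite !conf_concat_ge//; last exact: ltnW.
by rewrite conf_update gtn_eqF.
Qed.

(* Exchanging the first M spins of s with tau is an involution of the pairs
   (s, tau). *)
Lemma window_resample (R : realType) m M eta (F : Omega -> R) : (M <= m)%N ->
  \sum_(s : window m) \sum_(tau : window M) F (concat tau (concat s eta)) =
  #|{: window M}|%:R * \sum_(s : window m) F (concat s eta).
Proof.
move=> Mm; rewrite pair_big /=.
pose h (c : window m * window M) : window m * window M :=
  ([ffun t : 'I_m => if insub (t : nat) is Some u then c.2 u else c.1 t],
   [ffun u : 'I_M => c.1 (widen_ord Mm u)]).
have hK : involutive h.
  move=> [s tau]; rewrite /h /=; congr pair; apply/ffunP => t; rewrite !ffunE.
    case: insubP => [u _ ut|//]; rewrite ffunE; congr (s _); exact: val_inj.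
  case: insubP => [u _ ut|]; last by rewrite /= ltn_ord.
  by congr (tau _); exact: val_inj.
have hE c : concat c.2 (concat c.1 eta) = concat (h c).1 eta.
  case: c => s tau; apply: conf_inj => t; have [tm|mt] := ltnP t m; last first.
    by rewrite !conf_concat_ge// (leq_trans Mm).
  rewrite -[t in RHS]/(nat_of_ord (Ordinal tm)) conf_concat_lt ffunE.
  case: insubP => [u _ ut|].
    by move: ut => /= <-; rewrite conf_concat_lt.
  rewrite -leqNgt /= => Mt; rewrite conf_concat_ge//.
  by rewrite -[t in LHS]/(nat_of_ord (Ordinal tm)) conf_concat_lt.
under eq_bigr do rewrite hE.
transitivity (\sum_(c : window m * window M) F (concat c.1 eta)).
  by rewrite [RHS](reindex_inj (inv_inj hK)).
rewrite -(pair_bigA _ (fun (s : window m) (tau : window M) => F (concat s eta))) /=.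
rewrite mulr_sumr; apply: eq_bigr => s _.
by rewrite sumr_const mulr_natl.
Qed.

Definition past_event (i : L) (A : set Omega) := forall w w',
  (forall t, (`|site i| <= t)%N -> conf w t = conf w' t) -> A w -> A w'.

Lemma past_event_measurable i (A : set (Fle (site i))) :
  measurable A -> past_event i A.
Proof.
move=> mA w w' ww'; apply: coordSets_local mA _ => j.
rewrite /upto /= => ji; rewrite -(st_absz j); apply: ww'.
by have := site_le0 i; have := site_le0 j; lia.
Qed.

Section dlr.
Context {R : realType} (beta p : R) (p1 : 1 < p).

Let phi := isingPotential beta (powerCoupling p).

Definition boltz m w : R := beta * \sum_(t < m) chainField p (conf w) t.

Lemma energy_boltz i w : - energy phi i w = boltz `|site i|.+1 w.
Proof. by rewrite energyE// mulNr opprK. Qed.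

Lemma leftNumE i w : leftNum phi i w =
  \sum_(s : window `|site i|) expR (boltz `|site i|.+1 (concat s w)).
Proof. by apply: eq_bigr => s _; rewrite energy_boltz. Qed.

Lemma leftDenE i w : leftDen phi i w =
  \sum_(s : window `|site i|.+1) expR (boltz `|site i|.+1 (concat s w)).
Proof. by apply: eq_bigr => s _; rewrite energy_boltz. Qed.

Lemma leftNum_ext i w w' : (forall t, (`|site i| <= t)%N -> conf w t = conf w' t) ->
  leftNum phi i w = leftNum phi i w'.
Proof. by move=> ww'; apply: eq_bigr => s _; rewrite (concat_ext s ww'). Qed.

Lemma leftDen_ext i w w' : (forall t, (`|site i| < t)%N -> conf w t = conf w' t) ->
  leftDen phi i w = leftDen phi i w'.
Proof. by move=> ww'; apply: eq_bigr => s _; rewrite (concat_ext s ww'). Qed.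

Definition kerR i (A : set Omega) w : R :=
  \sum_(b : bool) leftDensity phi i (update i b w) * \1_A (update i b w).

Lemma isingLSS_kerE i A w : isingLSS beta (powerCoupling p) i w A = (kerR i A w)%:E.
Proof. exact: leftKerE. Qed.

Lemma past_event_indic i A w w' : past_event i A ->
  (forall t, (`|site i| <= t)%N -> conf w t = conf w' t) -> \1_A w = \1_A w' :> R.
Proof.
move=> pA ww'; rewrite !indicE; congr (_%:R); congr nat_of_bool.
by apply/idP/idP; rewrite !inE; apply: pA => t /ww'.
Qed.

Lemma leftDen_update i b w : leftDen phi i (update i b w) = leftDen phi i w.
Proof. by apply: leftDen_ext => t it; rewrite conf_update gtn_eqF. Qed.

Lemma kerR_ext i A w w' : past_event i A ->
  (forall t, (`|site i| < t)%N -> conf w t = conf w' t) -> kerR i A w = kerR i A w'.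
Proof.
move=> pA ww'; apply: eq_bigr => b _; rewrite /leftDensity !leftDen_update.
have uu t : (`|site i| <= t)%N -> conf (update i b w) t = conf (update i b w') t.
  by rewrite !conf_update leq_eqVlt eq_sym; case: eqP => //= _; exact: ww'.
by rewrite (leftNum_ext uu) (leftDen_ext ww') (past_event_indic pA uu).
Qed.

Lemma kerR_bounds i A w : 0 <= kerR i A w <= 1.
Proof.
have dens0 b : 0 <= leftDensity phi i (update i b w) by exact: leftDensity_ge0.
apply/andP; split; first by apply: sumr_ge0 => b _; rewrite mulr_ge0 ?indicE ?ler0n.
have := @leftKer_setT R phi i w.
rewrite leftKerE => -[<-]; apply: ler_sum => b _; rewrite ler_wpM2l//.
by rewrite !indicE in_setT ler_nat leq_b1.
Qed.

(** The factor [leftDen] clears the denominator of the density. The numerator sums over spins to the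
    right of [i], on which the indicator of a past event does not depend. *)
Lemma leftDen_kerR i A w : past_event i A -> leftDen phi i w * kerR i A w =
  \sum_(tau : window `|site i|.+1)
    expR (boltz `|site i|.+1 (concat tau w)) * \1_A (concat tau w).
Proof.
move=> pA.
rewrite (window_update i w (fun w => expR (boltz `|site i|.+1 w) * \1_A w)).
rewrite mulr_sumr; apply: eq_bigr => b _.
rewrite /leftDensity leftDen_update mulrA mulrCA divff ?gt_eqF ?leftDen_gt0//.
rewrite mulr1 leftNumE mulr_suml; apply: eq_bigr => tau _; congr (_ * _).
by apply: past_event_indic pA _ => t it; rewrite conf_concat_ge.
Qed.

(** The remainder [r] collects the bonds whose right end is at distance at least [M]; they do not
    involve the first [M] spins. *)
Lemma boltz_split m M : (M <= m)%N -> exists2 r : Omega -> R,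
  (forall w, boltz m w = r w + boltz M w) &
  (forall w w', (forall t, (M <= t)%N -> conf w t = conf w' t) -> r w = r w').
Proof.
move=> Mm; exists (fun w => beta * \sum_(M <= t < m) chainField p (conf w) t).
  move=> w; rewrite -mulrDr; congr (_ * _); rewrite -!(big_mkord xpredT).
  by rewrite (@big_cat_nat _ _ _ M)//= addrC.
move=> w w' ww'; congr (_ * _); apply: eq_big_nat => t /andP[Mt _].
by apply: chainField_ext => u tu; apply: ww'; exact: leq_trans tu.
Qed.

(** Resampling the spins in [i, 0] leaves [r] and [kerR i A] unchanged, and the inner sums then
    agree by [leftDen_kerR]. Multiplying by the number of windows on [i, 0] pays for the
    resampling. *)
Lemma dlr i A m eta : past_event i A -> (`|site i| < m)%N ->
  \sum_(s : window m) expR (boltz m (concat s eta)) * kerR i A (concat s eta) =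
  \sum_(s : window m) expR (boltz m (concat s eta)) * \1_A (concat s eta).
Proof.
move=> pA im; set M := `|site i|.+1.
have [r rE rext] := boltz_split im.
have cM0 : #|{: window M}|%:R != 0 :> R.
  by rewrite pnatr_eq0 -lt0n; apply/card_gt0P; exists [ffun=> true].
apply: (mulfI cM0).
rewrite -(window_resample eta (fun w => expR (boltz m w) * kerR i A w) im).
rewrite -(window_resample eta (fun w => expR (boltz m w) * \1_A w) im).
apply: eq_bigr => s _; set w := concat s eta.
have re tau : r (concat (tau : window M) w) = r w.
  by apply: rext => t Mt; rewrite conf_concat_ge.
have ke tau : kerR i A (concat (tau : window M) w) = kerR i A w.
  by apply: kerR_ext => // t Mt; rewrite conf_concat_ge.
under eq_bigr do rewrite rE re ke expRD -mulrA (mulrC _ (kerR _ _ _)).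
under [RHS]eq_bigr do rewrite rE re expRD -mulrA.
by rewrite -!mulr_sumr -leftDenE [kerR _ _ _ * _]mulrC leftDen_kerR.
Qed.

End dlr.

(** * Decay of the influence of the past *)

(** The ratios agree up to a factor exp(2d), and being at most 1 they differ by at most 1 - exp(-2d)
    <= 2d. *)
Lemma ratio_diff (R : realType) (d N N' D D' : R) : 0 <= d -> 0 < N -> 0 < N' -> 0 < D ->
  0 < D' -> N <= D -> N' <= D' ->
  N <= expR d * N' -> N' <= expR d * N -> D <= expR d * D' -> D' <= expR d * D ->
  `|N / D - N' / D'| <= 2 * d.
Proof.
have half (x x' y y' : R) : 0 <= d -> 0 < x -> 0 < x' -> 0 < y -> 0 < y' ->
    x <= y -> x <= expR d * x' -> y' <= expR d * y -> x / y - x' / y' <= 2 * d.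
  move=> d0 x0 x'0 y0 y'0 xy xx' yy'.
  have q1 : x / y <= 1 by rewrite ler_pdivrMr// mul1r.
  have q0 : 0 < x / y by rewrite divr_gt0.
  have h : expR (- (2 * d)) * (x / y) <= x' / y'.
    rewrite (_ : - (2 * d) = - d + - d); last by ring.
    rewrite expRD !expRN ler_pdivlMr//.
    apply: (@le_trans _ _ ((expR d)^-1 * (expR d)^-1 * (x / y) * (expR d * y))).
      by rewrite ler_wpM2l// ?mulr_ge0 ?invr_ge0 ?expR_ge0 ?ltW.
    rewrite (_ : _ * (expR d * y) = (expR d)^-1 * x); last first.
      by field; rewrite !gt_eqF ?expR_gt0.
    by rewrite ler_pdivrMl ?expR_gt0.
  have h2 : (1 + - (2 * d)) * (x / y) <= x' / y'.
    by apply: le_trans h; rewrite ler_wpM2r ?(ltW q0)//; exact: expR_ge1Dx.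
  by nra.
move=> *; rewrite ler_norml; apply/andP; split; last exact: half.
by rewrite lerNl opprB; apply: half.
Qed.

Section influence.
Context {R : realType} (beta p : R) (b0 : 0 <= beta) (p1 : 1 < p).

Let phi := isingPotential beta (powerCoupling p).

Definition influenceC (n : nat) : R := beta * (n.+1%:R * (2 * (1 + (p - 1)^-1))).

(** Bound for the change in the log-weight of the window [-n, 0] caused by the spins at distance [K]
    or more: [n.+1] copies of the bound in [chainField_diff], times [beta]. *)
Definition influence n K : R := influenceC n * pw (p - 1) (K - n)%N.

Lemma influenceC_ge0 n : 0 <= influenceC n.
Proof. by rewrite !mulr_ge0// addr_ge0// invr_ge0 subr_ge0 ltW. Qed.

Lemma influence_ge0 n K : 0 <= influence n K.
Proof. by rewrite mulr_ge0 ?influenceC_ge0 ?pw_ge0. Qed.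

Lemma boltz_diff n K w w' : (n < K)%N ->
  (forall u, (u < K)%N -> conf w u = conf w' u) ->
  `|boltz beta p n.+1 w - boltz beta p n.+1 w'| <= influence n K.
Proof.
move=> nK ww'; rewrite /boltz -mulrBr normrM ger0_norm// /influence /influenceC.
rewrite -!mulrA; apply: ler_wpM2l => //.
rewrite -sumrB; apply: le_trans (ler_norm_sum _ _ _) _.
rewrite mulr_natl -[X in _ *+ X](card_ord n.+1) -sumr_const.
apply: ler_sum => t _; have tn : (t <= n)%N by rewrite -ltnS.
apply: le_trans (@chainField_diff R p p1 _ _ K t ww' (leq_ltn_trans tn nK)) _.
rewrite !mulrA; apply: ler_wpM2l.
  by rewrite mulr_ge0// addr_ge0// invr_ge0 subr_ge0 ltW.
apply: pw_le; first by rewrite subr_ge0 ltW.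
by rewrite subn_gt0 nK leq_sub2l.
Qed.

Lemma concat_agree m (s : window m) K w w' :
  (forall u, (u < K)%N -> conf w u = conf w' u) ->
  forall u, (u < K)%N -> conf (concat s w) u = conf (concat s w') u.
Proof.
move=> ww' u uK; have [um|mu] := ltnP u m.
  by rewrite -[u]/(nat_of_ord (Ordinal um)) !conf_concat_lt.
by rewrite !conf_concat_ge// ww'.
Qed.

Lemma boltz_sum_le m i K w w' : (`|site i| < K)%N ->
  (forall u, (u < K)%N -> conf w u = conf w' u) ->
  \sum_(s : window m) expR (boltz beta p `|site i|.+1 (concat s w)) <=
  expR (influence `|site i| K) *
    \sum_(s : window m) expR (boltz beta p `|site i|.+1 (concat s w')).
Proof.
move=> iK ww'; rewrite mulr_sumr; apply: ler_sum => s _.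
rewrite -expRD ler_expR -lerBlDr.
have := @boltz_diff _ K (concat s w) (concat s w') iK (concat_agree s ww').
by apply: le_trans; exact: ler_norm.
Qed.

Lemma leftNum_le_leftDen i b w :
  leftNum phi i (update i b w) <= leftDen phi i (update i b w).
Proof.
rewrite leftDen_update// leftDenE// (window_update i w
  (fun w => expR (boltz beta p `|site i|.+1 w))).
rewrite leftNumE// (bigD1 b)//= lerDl.
by apply: sumr_ge0 => c _; apply: sumr_ge0 => s _; exact: expR_ge0.
Qed.

Lemma leftDensity_diff i K b w w' : (`|site i| < K)%N ->
  (forall u, (u < K)%N -> conf w u = conf w' u) ->
  `|leftDensity phi i (update i b w) - leftDensity phi i (update i b w')| <=
  2 * influence `|site i| K.
Proof.
move=> iK ww'.
have uu u : (u < K)%N -> conf (update i b w) u = conf (update i b w') u.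
  by move=> uK; rewrite !conf_update ww'.
have uu' u : (u < K)%N -> conf (update i b w') u = conf (update i b w) u.
  by move=> uK; rewrite uu.
apply: ratio_diff; rewrite ?influence_ge0 ?leftNum_gt0 ?leftDen_gt0 ?leftNum_le_leftDen//.
- by rewrite !leftNumE//; exact: boltz_sum_le.
- by rewrite !leftNumE//; exact: boltz_sum_le.
- by rewrite !leftDenE//; exact: boltz_sum_le.
- by rewrite !leftDenE//; exact: boltz_sum_le.
Qed.

Lemma condp_diff i K b w w' : (`|site i| < K)%N ->
  (forall u, (u < K)%N -> conf w u = conf w' u) ->
  `|condp (isingLSS beta (powerCoupling p)) i b w -
    condp (isingLSS beta (powerCoupling p)) i b w'| <= 2 * influence `|site i| K.
Proof. by move=> iK ww'; rewrite !condp_leftLSS; exact: leftDensity_diff. Qed.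

Lemma var_le i K : (`|site i| < K)%N ->
  var (st K) (isingLSS beta (powerCoupling p)) i <= 2 * influence `|site i| K.
Proof.
move=> iK; apply: ge_sup.
  exists `|condp (isingLSS beta (powerCoupling p)) i true (fun=> true) -
    condp (isingLSS beta (powerCoupling p)) i true (splice (st K) (fun=> true) (fun=> true))|.
  by exists (fun=> true) => //; exists (fun=> true).
move=> _ [w _ [s _ <-]]; apply: condp_diff => // u uK.
rewrite /conf /splice ifF//; apply/negbTE; rewrite -ltNge !site_st; lia.
Qed.

Lemma var_ge0 (f : LSS R) k i : 0 <= var k f i.
Proof.
rewrite /var; set S := (X in sup X).
have S0 : S `|condp f i true (fun=> true) - condp f i true (splice k (fun=> true) (fun=> true))|.
  by exists (fun=> true) => //; exists (fun=> true).
(* Without a supremum, [sup] takes its default value 0. *)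
have [hs|/sup_out ->//] := pselect (has_sup S).
by have /(_ _ S0) := sup_upper_bound hs; exact: le_trans.
Qed.

Lemma pw_sqr a n : pw a n ^+ 2 = pw (a * 2) n :> R.
Proof. by rewrite /pw -powR_mulrn ?powR_ge0// -powRrM mulNr. Qed.

Lemma sqsummable_ising : 3 / 2 < p ->
  sqsummable_var (isingLSS beta (powerCoupling p)).
Proof.
move=> p32 i; set n := `|site i|%N.
rewrite (_ : [set k : L | (site k < site i)%R] =
    (fun q => st (n + q.+1)%N) @` [set: nat]); last first.
  apply/seteqP; split => [k /= ki|_ [q _ <-] /=]; last first.
    by rewrite site_st /n; have := site_le0 i; lia.
  exists (`|site k| - n).-1 => //; rewrite -[RHS]st_absz; congr st.
  by rewrite /n; have := site_le0 i; have := site_le0 k; lia.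
rewrite esum_image; last by move=> q q' _ _ /st_inj; lia.
pose C := (2 * influenceC n) ^+ 2.
(* The variation at distance q + 1 from [i] is O((q+1)^(1-p)); its square is summable precisely
   because p > 3/2. *)
have p2 : 1 < (p - 1) * 2 by lra.
have cC : cvgn (series (fun q => C * pw ((p - 1) * 2) q.+1)).
  rewrite (_ : series _ = fun N => C * series (fun q => pw ((p - 1) * 2) q.+1) N).
    by apply: is_cvgM; [exact: is_cvg_cst|exact: cvg_pw_series].
  by apply/funext => N; rewrite /series /= mulr_sumr.
rewrite -nneseries_esumT => [|q]; last by rewrite lee_fin sqr_ge0.
apply: le_lt_trans (ltry (limn (series (fun q => C * pw ((p - 1) * 2) q.+1)))).
rewrite -nneseries_EFin//; apply: lee_nneseries => [q _|q _].
  by rewrite lee_fin sqr_ge0.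
rewrite lee_fin -pw_sqr /C -exprMn lerXn2r ?nnegrE ?var_ge0//.
  by rewrite mulr_ge0 ?pw_ge0// mulr_ge0 ?influenceC_ge0.
apply: le_trans (var_le _) _; first by rewrite addnS ltnS leq_addr.
by rewrite /influence -/n addKn mulrA.
Qed.

Lemma pw_small (a e : R) : 0 < a -> 0 < e -> exists q, pw a q.+1 <= e.
Proof.
move=> a0 e0; pose x := e `^ (- a^-1); have x0 : 0 < x by rewrite powR_gt0.
have := archi_boundP (ltW x0); set q := Num.bound x => xq; exists q.
have -> : e = x `^ (- a).
  by rewrite -powRrM mulNr mulrN opprK mulVf ?gt_eqF// powRr1// ltW.
rewrite /pw !powRN lef_pV2 ?posrE ?powR_gt0 ?ltr0n//.
rewrite ge0_ler_powR ?nnegrE ?ler0n ?(ltW x0) ?(ltW a0)//.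
by apply: le_trans (ltW xq) _; rewrite ler_nat.
Qed.

Lemma influence_small n e : 0 < e -> exists2 K, (n < K)%N &
  forall K', (K <= K')%N -> influence n K' <= e.
Proof.
move=> e0; have C0 := influenceC_ge0 n.
have a0 : 0 < p - 1 by rewrite subr_gt0.
have [q hq] := @pw_small (p - 1) (e / (influenceC n + 1)) a0
  (divr_gt0 e0 (ltr_wpDl C0 ltr01)).
exists (n + q.+1)%N => [|K' nK']; first by rewrite addnS ltnS leq_addr.
rewrite /influence.
apply: (@le_trans _ _ (influenceC n * (e / (influenceC n + 1)))).
  apply: ler_wpM2l => //; apply: le_trans hq; apply: pw_le; first exact: ltW.
  by apply/andP; split => //; lia.
rewrite mulrCA ler_piMr ?(ltW e0)// ler_pdivrMr; last exact: ltr_wpDl.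
by rewrite mul1r lerDl.
Qed.

Lemma nonnull_ising : nonnullLSS (isingLSS beta (powerCoupling p)).
Proof.
by move=> i b w; rewrite condp_leftLSS divr_gt0 ?leftNum_gt0 ?leftDen_gt0.
Qed.

Lemma nbhs_agree K (w : Omega) :
  nbhs w [set w' : Omega | forall u, (u < K)%N -> conf w u = conf w' u].
Proof.
elim: K => [|K IH]; first by apply: filterS filterT => w' _ u.
have hK : nbhs w [set w' : Omega | w (st K) = w' (st K)].
  have cproj : {for w, continuous (fun w' : Omega => w' (st K))}.
    exact: (@proj_continuous L (fun=> bool) (st K)).
  apply: (cproj [set b | w (st K) = b]).
  by apply: open_nbhs_nbhs; split => //; exact: discrete_open.
apply: filterS (filterI IH hK) => w' [h1 h2] u; rewrite ltnS leq_eqVlt.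
by case/orP => [/eqP ->|/h1].
Qed.

Lemma continuous_ising : continuousLSS (isingLSS beta (powerCoupling p)).
Proof.
move=> i b w; apply/cvgrPdist_le => e e0.
have [K iK hK] := @influence_small `|site i| (e / 2) (divr_gt0 e0 (ltr0Sn _ 1)).
apply: filterS (nbhs_agree K w) => w' ww'.
apply: le_trans (condp_diff b iK ww') _.
by have := hK K (leqnn _); lra.
Qed.

Lemma quasilocal_kerR i (A : set Omega) k0 :
  (forall w w', word k0 (conf w) = word k0 (conf w') -> A w -> A w') ->
  quasilocal (kerR beta p i A).
Proof.
move=> hA e e0.
(* A quarter: two values of the spin at [i], and the factor 2 in [leftDensity_diff]. *)
have [K iK hK] := @influence_small `|site i| (e / 4) (divr_gt0 e0 (ltr0Sn _ 3)).
exists (maxn k0 K) => w w' /word_inj ww'.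
have hww' u : (u < K)%N -> conf w u = conf w' u.
  by move=> uK; apply: ww'; rewrite leq_max uK orbT.
rewrite /kerR -sumrB; apply: le_trans (ler_norm_sum _ _ _) _.
apply: (@le_trans _ _ (\sum_(b : bool) (e / 2))); last first.
  by rewrite sumr_const card_bool -mulr_natr; lra.
apply: ler_sum => b _.
have -> : \1_A (update i b w') = \1_A (update i b w) :> R.
  have ew : word k0 (conf (update i b w)) = word k0 (conf (update i b w')).
    apply: word_ext => t tk; rewrite !conf_update ww'//.
    by rewrite leq_max tk.
  rewrite !indicE; congr (_%:R); congr nat_of_bool.
  by apply/idP/idP; rewrite !inE; apply: hA; rewrite ew.
rewrite -mulrBl normrM.
apply: (@le_trans _ _ (`|leftDensity phi i (update i b w) -
    leftDensity phi i (update i b w')| * 1)).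
  by rewrite ler_wpM2l// indicE normr_nat lern1 leq_b1.
rewrite mulr1; apply: le_trans (leftDensity_diff b iK hww') _.
by have := hK K (leqnn _); lra.
Qed.

End influence.

(** * Consistency reduced to events depending on finitely many spins *)

Section consistency.
Context {R : realType} (f : LSS R) (mu : probability OmegaF R) (i : L).

Lemma measurable_id_Fle n : measurable_fun setT (id : OmegaF -> Fle n).
Proof. by apply: measurable_Omega => j _; exact: (@measurable_coord setT j). Qed.

Lemma measurable_Fle n (A : set (Fle n)) : measurable A -> measurable (A : set OmegaF).
Proof.
move=> mA; rewrite -[A]setTI; exact: (@measurable_id_Fle n measurableT A mA).
Qed.

Lemma measurable_ker (A : set (Fle (site i))) : measurable A ->
  measurable_fun setT (fun w : OmegaF => f i w A).
Proof.
move=> mA.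
exact: (measurableT_comp (measurable_kernel (f i) A mA) (@measurable_id_Fle _)).
Qed.

(** This and [pastMarginal] are the two sides of the consistency equation, made into measures so
    that uniqueness of measures on a pi-system applies. *)
Definition kernelMean (A : set (Fle (site i))) : \bar R := (\int[mu]_w f i w A)%E.

Let kernelMean_set0 : kernelMean set0 = 0%E.
Proof. by rewrite /kernelMean integral0_eq. Qed.

Let kernelMean_ge0 A : (0 <= kernelMean A)%E.
Proof. exact: integral_ge0. Qed.

Let kernelMean_sigma_additive : semi_sigma_additive kernelMean.
Proof.
move=> F mF tF mUF; rewrite [X in _ --> X](_ : _ =
  \int[mu]_w (\sum_(n <oo) f i w (F n)))%E; last first.
  apply: eq_integral => w _.
  by apply/esym/cvg_lim => //; exact/measure_semi_sigma_additive.
apply/cvg_closeP; split.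
  by apply: is_cvg_nneseries => n _ _; exact: integral_ge0.
by rewrite closeE// integral_nneseries// => n; exact: measurable_ker.
Qed.

HB.instance Definition _ := isMeasure.Build _ (Fle (site i)) R
  kernelMean kernelMean_set0 kernelMean_ge0 kernelMean_sigma_additive.

Definition pastMarginal (A : set (Fle (site i))) : \bar R := mu A.

Let pastMarginal_set0 : pastMarginal set0 = 0%E.
Proof. exact: measure0. Qed.

Let pastMarginal_ge0 A : (0 <= pastMarginal A)%E.
Proof. exact: measure_ge0. Qed.

Let pastMarginal_sigma_additive : semi_sigma_additive pastMarginal.
Proof.
move=> F mF tF mUF; apply: (@measure_semi_sigma_additive _ _ _ mu F) => //.
- by move=> n; exact: measurable_Fle.
- exact: (measurable_Fle mUF).
Qed.

HB.instance Definition _ := isMeasure.Build _ (Fle (site i)) R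
  pastMarginal pastMarginal_set0 pastMarginal_ge0 pastMarginal_sigma_additive.

Definition finitary (A : set Omega) := exists k, forall w w' : Omega,
  word k (conf w) = word k (conf w') -> A w -> A w'.

(** Measurable finitary events are stable under intersection and contain the generating coordinate
    events. *)
Lemma finitary_consistent :
  (forall A : set (Fle (site i)), measurable A -> finitary A ->
    (\int[mu]_w f i w A = mu A)%E) ->
  forall A : set (Fle (site i)), measurable A -> (\int[mu]_w f i w A = mu A)%E.
Proof.
move=> h; pose G : set (set (Fle (site i))) :=
  [set A : set (Fle (site i)) | measurable A /\ finitary A].
have GT : G setT by split => //; exists 0%N.
apply: (@measure_unique _ R (Fle (site i)) G (fun=> setT) _ _ _ _ kernelMean pastMarginal).
- apply/seteqP; split.
    apply: smallest_sub; first exact: smallest_sigma_algebra.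
    move=> A [j [s [ji AE]]]; apply: sub_gen_smallest; split.
      by apply: sub_sigma_algebra; exists j, s.
    exists `|site j|.+1 => w w' /word_inj/(_ `|site j|%N (ltnSn _)).
    by rewrite AE /conf st_absz /= => <-.
  apply: smallest_sub; first exact: sigma_algebra_measurable.
  by move=> A [].
- move=> A B [mA [k hA]] [mB [l hB]]; split; first exact: measurableI.
  exists (maxn k l) => w w' /word_inj ww' [Aw Bw]; split.
    by apply: hA Aw; apply: word_ext => t tk; apply: ww'; rewrite leq_max tk.
  by apply: hB Bw; apply: word_ext => t tk; apply: ww'; rewrite leq_max tk orbT.
- by [].
- by apply/seteqP; split => // w _; exists 0%N.
- by move=> A [mA fA]; exact: h.
- move=> _; rewrite /= /kernelMean.
  under eq_integral do rewrite prob_kernel.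
  by rewrite integral_cst// mul1e (le_lt_trans (probability_le1 _ _)) ?ltry.
Qed.

End consistency.

(** * Phase transition *)

Section finite_volume.
Context {R : realType} (beta p : R) (eta : Omega).

Definition partition n : R := \sum_(s : window (sz n)) expR (boltz beta p (sz n) (concat s eta)).

Definition gibbsE n (F : Omega -> R) : R :=
  (\sum_(s : window (sz n)) expR (boltz beta p (sz n) (concat s eta)) * F (concat s eta))
  / partition n.

Lemma partition_gt0 n : 0 < partition n.
Proof. exact: sum_expR_gt0 [ffun=> true]. Qed.

Lemma gibbsED n F G : gibbsE n (fun w => F w + G w) = gibbsE n F + gibbsE n G.
Proof.
rewrite /gibbsE -mulrDl -big_split; congr (_ / _); apply: eq_bigr => s _.
by rewrite mulrDr.
Qed.

Lemma gibbsEZ n c F : gibbsE n (fun w => c * F w) = c * gibbsE n F.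
Proof.
rewrite /gibbsE mulrA; congr (_ / _); rewrite mulr_sumr; apply: eq_bigr => s _.
by rewrite mulrCA.
Qed.

Lemma gibbsE_ge0 n F : (forall w, 0 <= F w) -> 0 <= gibbsE n F.
Proof.
move=> F0; rewrite divr_ge0 ?(ltW (partition_gt0 n))//.
by apply: sumr_ge0 => s _; rewrite mulr_ge0 ?expR_ge0.
Qed.

Lemma gibbsE1 n : gibbsE n (fun=> 1) = 1.
Proof.
rewrite /gibbsE; under eq_bigr do rewrite mulr1.
by rewrite divff// gt_eqF// partition_gt0.
Qed.

Hypothesis p1 : 1 < p.

Lemma gibbsE_kerR i (A : set Omega) n : past_event i A -> (`|site i| < sz n)%N ->
  gibbsE n (kerR beta p i A) = gibbsE n (\1_A).
Proof. by move=> pA im; rewrite /gibbsE dlr. Qed.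

(** The finite-volume identity [gibbsE_kerR] holds once the window contains [i], hence along [U].
    Both of its sides are quasilocal observables, for which the limit is integration against
    [mu]. *)
Lemma exists_limit_chain (U : set_system nat) : UltraFilter U -> \oo `<=` U ->
  0 <= beta -> exists mu : probability OmegaF R,
    consistent (isingLSS beta (powerCoupling p)) mu /\
    mu [set w | w (st 0) = true] =
      (limE U gibbsE \1_[set w | w (st 0) = true])%:E.
Proof.
move=> UU ooU b0.
have [mu muE] := functional_representation gibbsED gibbsEZ gibbsE_ge0 gibbsE1 (U := U).
exists mu.
have q1 (A : set Omega) : finitary A -> quasilocal (\1_A : Omega -> R).
  move=> [k hA] e e0; exists k => w w' ww'.
  have -> : \1_A w = \1_A w' :> R.
    rewrite !indicE; congr (_%:R); congr nat_of_bool.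
    by apply/idP/idP; rewrite !inE; apply: hA; rewrite ww'.
  by rewrite subrr normr0 ltW.
have muA (A : set OmegaF) : measurable A -> finitary A ->
    mu A = (limE U gibbsE \1_A)%:E.
  move=> mA fA; rewrite -muE ?integral_indic ?setIT//.
  - by move=> w; rewrite indicE ler0n lern1 leq_b1.
  - exact: q1.
split.
  move=> i; apply: finitary_consistent => A mA fA.
  have pA := @past_event_measurable i A mA.
  under eq_integral do rewrite isingLSS_kerE.
  rewrite muE; last 3 first.
  - have := @measurable_ker R (isingLSS beta (powerCoupling p)) i A mA.
    rewrite (_ : (fun w : OmegaF => _) = EFin \o (kerR beta p i A : OmegaF -> R)).
      by move/measurable_EFinP.
    by apply/funext => w /=; rewrite -isingLSS_kerE.
  - by move=> w; exact: kerR_bounds.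
  - by have [k hA] := fA; apply: quasilocal_kerR hA.
  rewrite muA//; last exact: measurable_Fle mA.
  congr EFin; apply: (limE_near gibbsED gibbsEZ gibbsE_ge0 gibbsE1).
  - by exists 1 => w; have /andP[h0 h1] := kerR_bounds beta p i A w; rewrite ger0_norm.
  - by exists 1 => w; rewrite indicE normr_nat lern1 leq_b1.
  apply: ooU; exists `|site i|.+1 => // n /= iN; rewrite gibbsE_kerR//.
  rewrite szE; apply: leq_trans iN _; exact: ltnW (ltn_expl _ _).
apply: muA; first exact: (@coordSets_measurable setT (st 0) [set true]).
by exists 1%N => w w' /word_inj/(_ 0%N isT); rewrite /conf /mkset => ->.
Qed.

End finite_volume.

Section spin_flip.
Context {R : realType} (beta p : R).

Definition flipO (w : Omega) : Omega := fun j => ~~ w j.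

Lemma concat_flip m (s : window m) w : concat (wflip s) (flipO w) = flipO (concat s w).
Proof.
apply/funext => j; rewrite /flipO /concat; case: insubP => // t _ _.
by rewrite ffunE.
Qed.

Lemma boltz_flip m w : boltz beta p m (flipO w) = boltz beta p m w.
Proof.
congr (_ * _); apply: eq_bigr => t _; exact: (chainField_flip p (conf w)).
Qed.

(** Carries estimates for the plus boundary over to the minus boundary. *)
Lemma gibbsE_flip n eta F :
  gibbsE beta p (flipO eta) n F = gibbsE beta p eta n (F \o flipO).
Proof.
rewrite /gibbsE /partition; congr (_ / _);
  rewrite [LHS](reindex_inj (can_inj (@wflipK (sz n)))) /=;
  by apply: eq_bigr => s _; rewrite concat_flip boltz_flip.
Qed.

End spin_flip.

(** * Magnetization under the plus boundary condition *)

Section plus_boundary.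
Context {R : realType} (beta p : R) (hp : 1 < p < 2) (b0 : 0 < beta).

Let p1 : 1 < p. Proof. by case/andP: hp. Qed.
Let p2 : p < 2. Proof. by case/andP: hp. Qed.

Lemma boltz_window m (s : window m) :
  boltz beta p m (concat s (fun=> true)) =
  pairEnergy (fun d => beta * pw p d) s +
  \sum_(i < m) (beta * boundaryField p m i) * spin (s i).
Proof.
rewrite /boltz mulr_sumr -big_split; apply: eq_bigr => t _ /=.
rewrite (chainField_window p1 (m := m) (b := true)) => [|//|u mu]; last first.
  by rewrite conf_concat_ge.
rewrite mulrDr mulr_sumr; congr (_ + _); last first.
  by rewrite conf_concat_lt {1}/spin mul1r mulrA.
by apply: eq_bigr => j _; rewrite !conf_concat_lt mulrA.
Qed.

Lemma powR2X (a : R) n : (2 ^ n)%:R `^ a = (2 `^ a) ^+ n.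
Proof.
by rewrite natrX -powR_mulrn// -powRrM mulrC powRrM powR_mulrn ?powR_ge0.
Qed.

(** The ratio [r] of the hierarchical losses; p < 2 makes it smaller than 1. *)
Definition ratio : R := 2 `^ (p / 2) / 2.

Lemma ratio_itv : 0 <= ratio < 1.
Proof.
rewrite divr_ge0 ?powR_ge0//= ltr_pdivrMr// mul1r.
have -> : 2 `^ (p / 2) = expR (p / 2 * ln 2) :> R by rewrite /powR ifF// gt_eqF.
rewrite -[ltRHS](@lnK R 2) ?posrE// ltr_expR -[ltRHS]mul1r.
rewrite ltr_pM2r ?ln_gt0 ?ltr1n//; have := p2; lra.
Qed.

Lemma plus_magnetization n :
  1 - (Num.sqrt beta)^-1 * (1 - ratio)^-1 - 4 / beta <=
  gibbsE beta p (fun=> true) n (fun w => spin (w (st 0))).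
Proof.
(* Then k_j^2 = beta 2^(-pj), the coupling at distance 2^j and a lower bound for those at smaller
   distances. The field [h] below is the bound of [boundaryField_ge] times [beta]. *)
pose k j := Num.sqrt beta * pw (p / 2) (2 ^ j).
pose J d := beta * pw p d.
pose m := sz n; pose h := beta * (m%:R * pw p (m + m)).
have m0 : (0 < m)%N by exact: sz_gt0.
have m0' : 0 < m%:R :> R by rewrite ltr0n.
have h0 : 0 < h by rewrite !mulr_gt0// powR_gt0// ltr0n addn_gt0 m0.
have sb : 0 < Num.sqrt beta by rewrite sqrtr_gt0.
have := @ising_field_magnetization R k (Num.sqrt beta)^-1 ratio _ _ ratio_itv _ J n
  (fun i => beta * boundaryField p m i) h _ h0 _.
have -> : gibbsE beta p (fun=> true) n (fun w => spin (w (st 0))) =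
  gibbs_mean (fun s : window (sz n) => pairEnergy J s +
     \sum_(i < sz n) beta * boundaryField p m i * spin (s i)) (fun s => spin (s (site0 n))).
  rewrite /gibbsE /partition /gibbs_mean; congr (_ / _); apply: eq_bigr => s _.
    rewrite boltz_window mulrC; congr (spin _ * _).
    exact: (conf_concat_lt s (fun=> true) (site0 n)).
  by rewrite boltz_window.
move=> H; apply: le_trans (H _ _ _ _ _) => //.
(* The field error is 1/(h m) = (2m)^p / (beta m^2), at most 4/beta because p <= 2 and 2m >= 1. *)
- rewrite lerD2l lerN2 -[4 / beta]invf_div lef_pV2 ?posrE ?divr_gt0//; last first.
    by rewrite mulr_gt0// exprn_gt0.
  rewrite /h -natrX -szE -/m -mulrA; apply: ler_wpM2l; first exact: ltW.
  rewrite mulrAC -expr2.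
  have -> : 4^-1 = m%:R ^+ 2 * ((m + m)%:R `^ (- 2%:R)) :> R.
    by rewrite powR_invn ?ler0n// natrD; field; rewrite gt_eqF//= addr_gt0.
  apply: ler_wpM2l; first exact: sqr_ge0.
  by rewrite /pw ler_powR ?ler1n ?addn_gt0 ?m0// lerN2 ltW.
- by move=> j; rewrite mulr_gt0// powR_gt0// ltr0n expn_gt0.
- move=> j; rewrite invfM ler_wpM2l ?invr_ge0 ?(ltW sb)//.
  rewrite /pw powRN invrK powR2X /ratio mulrCA divff ?mulr1//.
- move=> N d /andP[d0 dN]; rewrite exprMn sqr_sqrtr ?(ltW b0)// pw_sqr.
  rewrite divfK//; apply: ler_wpM2l; first exact: ltW.
  by apply: pw_le; [apply: ltW; apply: lt_trans p1|rewrite d0 ltnW].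
- by move=> i; apply: ler_wpM2l; [exact: ltW|exact: boundaryField_ge].
Qed.

End plus_boundary.

Lemma phase_transition (R : realType) (p : R) : 1 < p < 2 ->
  \forall beta \near +oo, several_chains (isingLSS beta (powerCoupling p)).
Proof.
move=> hp; have p1 : 1 < p by case/andP: hp.
have /andP[r0 r1] := ratio_itv hp.
near=> beta.
(* This and [br] make each of the two errors in [plus_magnetization] at most 1/4, leaving
   magnetization at least 1/2. *)
have b16 : 16 <= beta by near: beta; apply: nbhs_pinfty_ge; rewrite num_real.
have br : (4 * (1 - ratio p)^-1) ^+ 2 <= beta.
  by near: beta; apply: nbhs_pinfty_ge; rewrite num_real.
have b0 : 0 < beta by apply: lt_le_trans b16.
have mag n : 1 / 2 <= gibbsE beta p (fun=> true) n (fun w => spin (w (st 0))).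
  apply: le_trans (plus_magnetization hp b0 n).
  have h1 : 4 / beta <= 1 / 4 by rewrite ler_pdivrMr//; lra.
  have q0 : 0 < (1 - ratio p)^-1 by rewrite invr_gt0 subr_gt0.
  have h2 : (Num.sqrt beta)^-1 * (1 - ratio p)^-1 <= 1 / 4.
    rewrite ler_pdivrMl ?sqrtr_gt0//.
    have : 4 * (1 - ratio p)^-1 <= Num.sqrt beta.
      by rewrite -[leLHS]ger0_norm ?mulr_ge0 ?(ltW q0)// -sqrtr_sqr ler_sqrt// ltW.
    lra.
  lra.
have [U [UU ooU]] := ultraFilterLemma (eventually_filter : ProperFilter \oo).
have [mu [cmu muE]] := exists_limit_chain (fun=> true) p1 UU ooU (ltW b0).
have [nu [cnu nuE]] := exists_limit_chain (fun=> false) p1 UU ooU (ltW b0).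
have lt1434 : 1 / 4 < 3 / 4 :> R by lra.
exists mu, nu; split => // /(_ [set w : Omega | w (st 0) = true]).
have mA : measurable ([set w : Omega | w (st 0) = true] : set OmegaF).
  exact: (@coordSets_measurable setT (st 0) [set true]).
move=> /(_ mA) munu; move: muE nuE.
set A : set Omega := [set w | _].
(* Magnetization at least 1/2 thus gives the event [A] probability at least 3/4 under the plus
   boundary, and the spin flip gives at most 1/4 under the minus boundary. *)
have AE w : \1_A w = 1 / 2 + 1 / 2 * spin (w (st 0)) :> R.
  rewrite indicE /A; case e : (w (st 0)).
    by rewrite mem_set// -[LHS]/(1 : R) /spin; lra.
  by rewrite memNset /= ?e// -[LHS]/(0 : R) /spin; lra.
have plusE n : 3 / 4 <= gibbsE beta p (fun=> true) n \1_A.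
  rewrite (_ : \1_A = fun w => 1 / 2 * (fun=> 1) w + 1 / 2 * spin (w (st 0))); last first.
    by apply/funext => w; rewrite AE mulr1.
  rewrite gibbsED !gibbsEZ gibbsE1; have := mag n; lra.
have minusE n : gibbsE beta p (fun=> false) n \1_A <= 1 / 4.
  rewrite (_ : (fun=> false) = flipO (fun=> true)) ?gibbsE_flip//.
  rewrite (_ : _ \o _ = fun w => 1 / 2 * (fun=> 1) w + (- (1 / 2)) * spin (w (st 0))); last first.
    by apply/funext => w; rewrite /= AE /flipO spin_negb; lra.
  rewrite gibbsED !gibbsEZ gibbsE1; have := mag n; lra.
have bA : bounded_obs (\1_A : Omega -> R).
  by exists 1 => w; rewrite indicE normr_nat lern1 leq_b1.
have hp' : 3 / 4 <= limE U (gibbsE beta p (fun=> true)) \1_A.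
  apply: (cvgr_to_ge (cvg_limE (@gibbsED _ _ _ _) (@gibbsEZ _ _ _ _)
    (@gibbsE_ge0 _ _ _ _) (@gibbsE1 _ _ _ _) (U := U) bA)).
  exact: nearW.
have hm : limE U (gibbsE beta p (fun=> false)) \1_A <= 1 / 4.
  apply: (cvgr_to_le (cvg_limE (@gibbsED _ _ _ _) (@gibbsEZ _ _ _ _)
    (@gibbsE_ge0 _ _ _ _) (@gibbsE1 _ _ _ _) (U := U) bA)).
  exact: nearW.
move=> muA nuA; have : (mu A <= (1 / 4)%:E)%E by rewrite munu nuA lee_fin.
by rewrite muA lee_fin => /(le_trans hp'); rewrite leNgt lt1434.
Unshelve. all: by end_near. Qed.

Theorem mainTheorem6 (R : realType) (p : R) (hp : 3 / 2 < p < 2) :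
  [/\ forall beta : R, 0 < beta ->
        sqsummable_var (isingLSS beta (powerCoupling p)),
      \forall beta \near +oo, several_chains (isingLSS beta (powerCoupling p))
    & ~ (forall f : LSS R, continuousLSS f -> nonnullLSS f ->
           sqsummable_var f -> unique_chain f)].
Proof.
have /andP[p32 p2] := hp; have p1 : 1 < p by lra.
have sq (beta : R) : 0 < beta -> sqsummable_var (isingLSS beta (powerCoupling p)).
  by move=> b0; apply: sqsummable_ising => //; exact: ltW.
have pt : \forall beta \near +oo, several_chains (isingLSS beta (powerCoupling p)).
  by apply: phase_transition; rewrite p1.
split=> // crit.
have [beta [b0 [mu [nu [cmu cnu]]]]] := filter_ex (filterI (nbhs_pinfty_gt (num_real 0)) pt).
have [rho [_ rhoE]] := crit _ (continuous_ising (ltW b0) p1) (@nonnull_ising R beta p) (sq beta b0).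
by apply=> A mA; rewrite -(rhoE mu)// -(rhoE nu).
Qed.
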